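(* The following problem can be solved in polynomial time: given a finite disjunction-free normal default theory $\langle D,W\rangle$, where $W$ is a set of Horn clauses or $W$ is a set of 2-literal clauses, a strict total order $\mathcal{P}$ on $D$, and a literal $\phi$, decide whether $\langle D,W\rangle\models^{B}_{\mathcal{P}}\phi$.
   Context: $\mathcal{L}$ is the set of formulae of classical propositional logic, $\models$ classical logical consequence, and $Cn(S)=\{\phi\in\mathcal{L}\mid S\models\phi\}$ for $S\subseteq\mathcal{L}$. A normal default is a rule $\alpha{:}\beta/\beta$ with $\alpha,\beta\in\mathcal{L}$. A normal default theory is a pair $\langle D,W\rangle$ with $D$ a set of normal defaults and $W\subseteq\mathcal{L}$. It is disjunction-free normal if all its defaults have the form $$\frac{a_1\wedge\cdots\wedge a_i : b_1\wedge\cdots\wedge b_n}{b_1\wedge\cdots\wedge b_n}$$ where all $a_j,b_j$ are literals (the prerequisite may be empty). $\delta\mathcal{P}\delta'$ means that $\delta$ has higher priority than $\delta'$. A default $\alpha{:}\beta/\gamma$ is active in $E\subseteq\mathcal{L}$ if $E\models\alpha$, $E\not\models\neg\beta$ and $E\not\models\gamma$. For a strict partial order $\mathcal{P}$ on $D$, a set $E\subseteq\mathcal{L}$ is a $\mathcal{P}$-preferred$^B$ extension of $\langle D,W\rangle$ if there is a strict total order $\mathcal{T}$ on $D$ with $\mathcal{P}\subseteq\mathcal{T}$ such that $E=\bigcup_{i\ge 0}Cn(E_i)$, where $E_0=W$ and for all $i\ge 0$, $$E_{i+1}=E_i\cup\{\beta\mid \alpha{:}\beta/\beta\in D,\ E_i\models\alpha,\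 E_i\not\models\neg\beta,\ \text{no }\delta\in D\text{ with }\delta\,\mathcal{T}\,(\alpha{:}\beta/\beta)\text{ is active in }E_i\}.$$ $\langle D,W\rangle\models^B_{\mathcal{P}}\phi$ means that $\phi$ belongs to all $\mathcal{P}$-preferred$^B$ extensions of $\langle D,W\rangle$. *)

(* Defs.v *)
From HB Require Import structures.
From mathcomp Require Import all_boot all_order all_algebra.
From mathcomp Require Import boolp classical_sets.

Set Implicit Arguments.
Unset Strict Implicit.
Unset Printing Implicit Defensive.

Local Open Scope classical_set_scope.

(** * Classical propositional logic *)

Inductive form : Type :=
| Var of nat
| Top
| Bot
| Not of form
| And of form & form
| Or of form & form
| Imp of form & form.

Fixpoint eval (v : nat -> bool) (f : form) : bool :=
  match f with
  | Var x => v x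
  | Top => true
  | Bot => false
  | Not f => ~~ eval v f
  | And f g => eval v f && eval v g
  | Or f g => eval v f || eval v g
  | Imp f g => eval v f ==> eval v g
  end.

Definition entails (S : set form) (f : form) : Prop :=
  forall v : nat -> bool, (forall g, S g -> eval v g) -> eval v f.

Definition Cn (S : set form) : set form := [set f | entails S f].

(** * Prioritized normal default logic *)

(* [NDefault a b] is the normal default a : b / b *)
Record ndefault : Type := NDefault { prereq : form; conseq : form }.

Definition active (E : set form) (d : ndefault) : Prop :=
  [/\ entails E (prereq d),
      ~ entails E (Not (conseq d)) &
      ~ entails E (conseq d)].

(* In all relations on defaults, (d, d') means that d has higher priority. *)
Definition strict_partial_order (D : set ndefault)
    (R : set (ndefault * ndefault)) : Prop :=
  [/\ forall d d', R (d, d') -> D d /\ D d',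
      forall d, ~ R (d, d) &
      forall d1 d2 d3, R (d1, d2) -> R (d2, d3) -> R (d1, d3)].

Definition strict_total_order (D : set ndefault)
    (R : set (ndefault * ndefault)) : Prop :=
  strict_partial_order D R /\
  forall d d', D d -> D d' -> d <> d' -> R (d, d') \/ R (d', d).

Fixpoint stage (D : set ndefault) (W : set form)
    (T : set (ndefault * ndefault)) (i : nat) : set form :=
  if i is j.+1 then
    let E := stage D W T j in
    E `|` [set conseq d | d in [set d | [/\ D d,
                                           entails E (prereq d),
                                           ~ entails E (Not (conseq d)) &
             ~ exists d', [/\ D d', T (d', d) & active E d']]]]
  else W.

Definition preferred_extension (D : set ndefault) (W : set form)
    (P : set (ndefault * ndefault)) (E : set form) : Prop :=
  exists T : set (ndefault * ndefault),
    [/\ strict_total_order D T,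
        P `<=` T &
        E = \bigcup_i Cn (stage D W T i)].

Definition entails_B (D : set ndefault) (W : set form)
    (P : set (ndefault * ndefault)) (f : form) : Prop :=
  forall E, preferred_extension D W P E -> E f.

(** * Problem instances *)

(* (true, x) is the atom x, and (false, x) is its negation *)
Definition lit : Type := (bool * nat)%type.

Definition lit_form (l : lit) : form := if l.1 then Var l.2 else Not (Var l.2).

Fixpoint conj_form (s : seq lit) : form :=
  match s with
  | [::] => Top
  | [:: l] => lit_form l
  | l :: s' => And (lit_form l) (conj_form s')
  end.

Fixpoint clause_form (s : seq lit) : form :=
  match s with
  | [::] => Bot
  | [:: l] => lit_form l
  | l :: s' => Or (lit_form l) (clause_form s')
  end.

(* (a, b) is the default whose prerequisite is the conjunction of a and whose
   justification and conclusion are the conjunction of b *)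
Definition df_default : Type := (seq lit * seq lit)%type.

Definition default_form (d : df_default) : ndefault :=
  NDefault (conj_form d.1) (conj_form d.2).

Record instance : Type := Instance {
  inst_defaults : seq df_default;
  inst_clauses : seq (seq lit);
  inst_prio : seq (df_default * df_default);
  inst_query : lit }.

Definition inst_D (I : instance) : set ndefault :=
  [set default_form d | d in [set` inst_defaults I]].

Definition inst_W (I : instance) : set form :=
  [set clause_form c | c in [set` inst_clauses I]].

Definition inst_P (I : instance) : set (ndefault * ndefault) :=
  [set (default_form p.1, default_form p.2) | p in [set` inst_prio I]].

Definition horn (c : seq lit) : bool := (count (fun l : lit => l.1) c <= 1)%N.

Definition two_literal (c : seq lit) : bool := size c == 2.

(* Prerequisites may be empty, conclusions may not. *)
Definition valid_instance (I : instance) : Prop :=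
  [/\ all (fun d : df_default => d.2 != [::]) (inst_defaults I),
      all horn (inst_clauses I) || all two_literal (inst_clauses I) &
      strict_total_order (inst_D I) (inst_P I)].

Definition yes_instance (I : instance) : Prop :=
  entails_B (inst_D I) (inst_W I) (inst_P I) (lit_form (inst_query I)).

(** * Binary encoding of instances *)

(* Every code below is self-delimiting, so codes can be concatenated. *)
Definition enc_seq (A : Type) (enc : A -> seq bool) (s : seq A) : seq bool :=
  flatten [seq true :: enc x | x <- s] ++ [:: false].

(* least significant digit first *)
Definition binary_digits (n : nat) : seq bool :=
  [seq odd (n %/ 2 ^ i) | i <- iota 0 (trunc_log 2 n).+1].

Definition enc_nat (n : nat) : seq bool :=
  enc_seq (fun b : bool => [:: b]) (binary_digits n).

Definition enc_lit (l : lit) : seq bool := l.1 :: enc_nat l.2.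

Definition enc_default (d : df_default) : seq bool :=
  enc_seq enc_lit d.1 ++ enc_seq enc_lit d.2.

Definition enc_instance (I : instance) : seq bool :=
  enc_seq enc_default (inst_defaults I) ++
  enc_seq (enc_seq enc_lit) (inst_clauses I) ++
  enc_seq (fun p => enc_default p.1 ++ enc_default p.2) (inst_prio I) ++
  enc_lit (inst_query I).

(** * Deterministic multi-tape Turing machines and polynomial time *)

Inductive move : Type := MoveLeft | Stay | MoveRight.

(* [None] is the blank, [Some (inl b)] an input symbol, and [Some (inr g)] an
   additional work symbol *)
Definition symbol (G : Type) : Type := option (bool + G).

(* A two-way infinite tape: the cells to the left of the head (nearest first),
   the scanned cell, and the cells to its right (nearest first); all the cells
   beyond the two lists are blank. *)
Record tape (G : Type) : Type := Tape {
  tape_left : seq (symbol G);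
  tape_cur : symbol G;
  tape_right : seq (symbol G) }.

Definition tape_of (G : Type) (s : seq (symbol G)) : tape G :=
  Tape [::] (head None s) (behead s).

Definition tape_act (G : Type) (a : symbol G * move) (t : tape G) : tape G :=
  let: Tape l _ r := t in
  match a.2 with
  | MoveLeft => Tape (behead l) (head None l) (a.1 :: r)
  | Stay => Tape l a.1 r
  | MoveRight => Tape (a.1 :: l) (head None r) (behead r)
  end.

(* Tape 0 holds the input. The machine halts when [tm_trans] returns [None]. *)
Record machine : Type := Machine {
  tm_work_tapes : nat;
  tm_work_symbol : finType;
  tm_state : finType;
  tm_start : tm_state;
  tm_accept : pred tm_state;
  tm_trans : tm_state -> {ffun 'I_tm_work_tapes.+1 -> symbol tm_work_symbol} ->
    option (tm_state *
            {ffun 'I_tm_work_tapes.+1 -> symbol tm_work_symbol * move}) }.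

Definition config (M : machine) : Type :=
  (tm_state M * {ffun 'I_(tm_work_tapes M).+1 -> tape (tm_work_symbol M)})%type.

Definition tm_init (M : machine) (w : seq bool) : config M :=
  (tm_start M,
   [ffun i => tape_of (if i == ord0 then [seq Some (inl b) | b <- w]
                       else [::])]).

Definition tm_next (M : machine) (c : config M) :=
  tm_trans c.1 [ffun i => tape_cur (c.2 i)].

Definition tm_halted (M : machine) (c : config M) : bool :=
  ~~ isSome (tm_next c).

Definition tm_step (M : machine) (c : config M) : config M :=
  if tm_next c is Some (q, a) then (q, [ffun i => tape_act (a i) (c.2 i)])
  else c.

(* The decision problem whose instances are the x satisfying [valid], and whose
   yes-instances are those which moreover satisfy [yes] *)
Definition poly_time_decidable (X : Type) (enc : X -> seq bool)
    (valid yes : X -> Prop) : Prop :=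
  exists (M : machine) (p : {poly nat}), forall x : X, valid x ->
    exists2 n : nat, (n <= p.[size (enc x)]%R)%N &
      let c := iter n (@tm_step M) (tm_init M (enc x)) in
      tm_halted c /\ (tm_accept c.1 <-> yes x).

(* Main.v *)
From HB Require Import structures.
From mathcomp Require Import all_boot all_order all_algebra.
From mathcomp Require Import boolp classical_sets.
From mathcomp Require Import zify.
Require Import Defs.

(* A strict total order P admits no proper extension, so there is exactly one
   preferred extension, and the stages of its construction are obtained by
   repeatedly firing defaults; after as many rounds as there are defaults,
   nothing changes any more. Since the prerequisites and conclusions are
   conjunctions of literals, every test made in a round is whether W together
   with some literals is satisfiable. For Horn clauses unit propagation decides
   this. For 2-literal clauses it suffices that for no variable do both values
   lead to a conflict by unit propagation: after propagating a harmless value,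
   the clauses that have not been touched form a smaller set of the same kind,
   and its variables are still free. As the second test is sound, and complete
   in both cases, one algorithm serves for both.

   To run the algorithm on a Turing machine, while-programs over four stacks of
   bits are compiled to machines. Data are binary trees written in prefix order,
   hence self-delimiting, so that a program acting on the top of the main stack
   ignores what lies below, and the functions computed in polynomial time are
   closed under composition, pairing, case analysis and bounded iteration. *)

Set Implicit Arguments.
Unset Strict Implicit.
Unset Printing Implicit Defensive.

(** * Stack programs and their compilation *)

Inductive cmd : Type :=
| Push of 'I_4 & bool
| Pop of 'I_4
| Seq of cmd & cmd
| Ite of (option bool -> bool) & 'I_4 & cmd & cmd
| While of (option bool -> bool) & 'I_4 & cmd.

Notation "c1 ;; c2" := (Seq c1 c2) (at level 90, right associativity).

Definition stacks : Type := seq (seq bool).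

Notation stack s i := (nth [::] s (nat_of_ord i)).
Notation set_stack s i v := (set_nth [::] s (nat_of_ord i) v).

(** The number counts machine steps exactly: a push takes two, one to move left onto a blank cell
    and one to write, while a pop and every test take one. *)
Inductive exec : cmd -> stacks -> nat -> stacks -> Prop :=
| ExecPush i b s : exec (Push i b) s 2 (set_stack s i (b :: stack s i))
| ExecPop i s : exec (Pop i) s 1 (set_stack s i (behead (stack s i)))
| ExecSeq c1 c2 s n s1 m s2 :
    exec c1 s n s1 -> exec c2 s1 m s2 -> exec (c1 ;; c2) s (n + m) s2
| ExecIteT (p : option bool -> bool) i c1 c2 s n s1 :
    p (ohead (stack s i)) -> exec c1 s n s1 -> exec (Ite p i c1 c2) s n.+1 s1
| ExecIteF (p : option bool -> bool) i c1 c2 s n s1 :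
    ~~ p (ohead (stack s i)) -> exec c2 s n s1 -> exec (Ite p i c1 c2) s n.+1 s1
| ExecWhileT (p : option bool -> bool) i c s n s1 m s2 :
    p (ohead (stack s i)) -> exec c s n s1 -> exec (While p i c) s1 m s2 ->
    exec (While p i c) s (n + m).+1 s2
| ExecWhileF (p : option bool -> bool) i c s :
    ~~ p (ohead (stack s i)) -> exec (While p i c) s 1 s.

(** * Machine semantics of programs *)

Definition sym : Type := symbol void.
Definition written (b : bool) : sym := Some (inl b).
Definition tapes : Type := {ffun 'I_4 -> tape void}.
Definition actions : Type := {ffun 'I_4 -> sym * move}.

Definition scan (t : tapes) : {ffun 'I_4 -> sym} := [ffun i => tape_cur (t i)].
Definition act (a : actions) (t : tapes) : tapes := [ffun i => tape_act (a i) (t i)].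

(** For a conditional or a loop, [None] is the state in which the test is made. *)
Fixpoint ctrl (c : cmd) : finType :=
  match c with
  | Push _ _ => bool
  | Pop _ => unit
  | Seq c1 c2 => (ctrl c1 + ctrl c2)%type
  | Ite _ _ c1 c2 => option (ctrl c1 + ctrl c2)
  | While _ _ c => option (ctrl c)
  end.

Fixpoint entry (c : cmd) : ctrl c :=
  match c with
  | Push _ _ => false
  | Pop _ => tt
  | Seq c1 c2 => inl (entry c1)
  | Ite _ _ _ _ => None
  | While _ _ _ => None
  end.

Definition bit_of (a : sym) : option bool :=
  if a is Some (inl b) then Some b else None.

Definition idle (r : {ffun 'I_4 -> sym}) : actions := [ffun i => (r i, Stay)].
Definition on_tape (i : 'I_4) (a : sym * move) (r : {ffun 'I_4 -> sym}) : actions :=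
  [ffun j => if j == i then a else (r j, Stay)].

(* The target [None] exits the program. *)
Fixpoint trans (c : cmd) : ctrl c -> {ffun 'I_4 -> sym} ->
    option (ctrl c) * actions :=
  match c with
  | Push i b => fun q r =>
      if q then (None, on_tape i (Some (inl b), Stay) r)
      else (Some true, on_tape i (r i, MoveLeft) r)
  | Pop i => fun _ r => (None, on_tape i (None, MoveRight) r)
  | Seq c1 c2 => fun q r =>
      match q with
      | inl q1 => let: (q', a) := trans q1 r in
                  (Some (if q' is Some q1' then inl q1' else inr (entry c2)), a)
      | inr q2 => let: (q', a) := trans q2 r in (omap inr q', a)
      end
  | Ite p i c1 c2 => fun q r =>
      match q with
      | None => (Some (Some (if p (bit_of (r i)) then inl (entry c1)
                             else inr (entry c2))), idle r)
      | Some (inl q1) => let: (q', a) := trans q1 r in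
                         (omap (fun x => Some (inl x)) q', a)
      | Some (inr q2) => let: (q', a) := trans q2 r in
                         (omap (fun x => Some (inr x)) q', a)
      end
  | While p i c => fun q r =>
      match q with
      | None => (if p (bit_of (r i)) then Some (Some (entry c)) else None, idle r)
      | Some q1 => let: (q', a) := trans q1 r in (Some q', a)
      end
  end.

Inductive reach (c : cmd) : ctrl c -> tapes -> nat -> tapes -> Prop :=
| ReachExit q t a : trans q (scan t) = (None, a) -> reach q t 1 (act a t)
| ReachStep q t q' a n t' :
    trans q (scan t) = (Some q', a) -> reach q' (act a t) n t' ->
    reach q t n.+1 t'.

(** The top of the stack lies under the head and the rest to its right. Head movements leave
    explicit blanks at both ends, so their numbers [n] and [m] are left open. *)
Definition holds_stack (t : tape void) (s : seq bool) : Prop :=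
  exists n m, t = Tape (nseq n None) (head None (map written s))
    (behead (map written s) ++ nseq m None).

Definition holds (t : tapes) (s : stacks) : Prop :=
  forall i, holds_stack (t i) (stack s i).

Lemma holds_scan t s i : holds t s -> bit_of (scan t i) = ohead (stack s i).
Proof. by move=> /(_ i) [n [m e]]; rewrite ffunE e; case: (stack s i). Qed.

Lemma act_idle t : act (idle (scan t)) t = t.
Proof. by apply/ffunP => i; rewrite !ffunE; case: (t i). Qed.

Lemma act_on_tape i a t j :
  act (on_tape i a (scan t)) t j = if j == i then tape_act a (t j) else t j.
Proof. by rewrite !ffunE; case: eqP => // _; case: (t j). Qed.

Lemma set_stackE (s : stacks) (i j : 'I_4) (v : seq bool) :
  stack (set_stack s i v) j = if j == i then v else stack s j.
Proof. by rewrite nth_set_nth. Qed.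

Lemma reach_seqr c1 c2 (q : ctrl c2) t n t1 :
  reach q t n t1 -> @reach (c1 ;; c2) (inr q) t n t1.
Proof.
elim=> [{}q {}t a e|{}q {}t q' a {}n t' e _ IH].
  by apply: (@ReachExit (c1 ;; c2)); rewrite /= e.
by apply: (@ReachStep (c1 ;; c2)) IH; rewrite /= e.
Qed.

Lemma reach_seql c1 c2 (q : ctrl c1) t n t1 m t2 :
  reach q t n t1 -> reach (entry c2) t1 m t2 ->
  @reach (c1 ;; c2) (inl q) t (n + m) t2.
Proof.
elim=> [{}q {}t a e|{}q {}t q' a {}n t' e _ IH] r2.
  by apply: (@ReachStep (c1 ;; c2)) (reach_seqr c1 r2); rewrite /= e.
by rewrite addSn; apply: (@ReachStep (c1 ;; c2)) (IH r2); rewrite /= e.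
Qed.

Lemma reach_itel p i c1 c2 (q : ctrl c1) t n t1 :
  reach q t n t1 -> @reach (Ite p i c1 c2) (Some (inl q)) t n t1.
Proof.
elim=> [{}q {}t a e|{}q {}t q' a {}n t' e _ IH].
  by apply: (@ReachExit (Ite p i c1 c2)); rewrite /= e.
by apply: (@ReachStep (Ite p i c1 c2)) IH; rewrite /= e.
Qed.

Lemma reach_iter p i c1 c2 (q : ctrl c2) t n t1 :
  reach q t n t1 -> @reach (Ite p i c1 c2) (Some (inr q)) t n t1.
Proof.
elim=> [{}q {}t a e|{}q {}t q' a {}n t' e _ IH].
  by apply: (@ReachExit (Ite p i c1 c2)); rewrite /= e.
by apply: (@ReachStep (Ite p i c1 c2)) IH; rewrite /= e.
Qed.

Lemma reach_while p i c (q : ctrl c) t n t1 m t2 :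
  reach q t n t1 -> @reach (While p i c) None t1 m t2 ->
  @reach (While p i c) (Some q) t (n + m) t2.
Proof.
elim=> [{}q {}t a e|{}q {}t q' a {}n t' e _ IH] r2.
  by apply: (@ReachStep (While p i c)) r2; rewrite /= e.
by rewrite addSn; apply: (@ReachStep (While p i c)) (IH r2); rewrite /= e.
Qed.

Lemma holds_stack_pop t s :
  holds_stack t s -> holds_stack (tape_act (None, MoveRight) t) (behead s).
Proof.
case=> n [m ->]; exists n.+1; case: s => [|b [|b' s]] /=.
- by exists m.-1; case: m.
- by exists m.-1; case: m.
- by exists m.
Qed.

Lemma holds_stack_push t s b : holds_stack t s ->
  holds_stack (tape_act (Some (inl b), Stay)
    (tape_act (tape_cur t, MoveLeft) t)) (b :: s).
Proof.
case=> n [m ->]; exists n.-1.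
by case: s => [|b' s] /=; [exists m.+1; case: n | exists m; case: n].
Qed.

(** Program and machine run in lockstep, so the step count carries over unchanged. *)
Lemma exec_reach c s n s' t : exec c s n s' -> holds t s ->
  exists2 t', reach (entry c) t n t' & holds t' s'.
Proof.
move=> e; elim: e t => {c s n s'}
  [i b s|i s|c1 c2 s n s1 m s2 _ IH1 _ IH2|p i c1 c2 s n s1 ps _ IH
  |p i c1 c2 s n s1 ps _ IH|p i c s n s1 m s2 ps _ IH1 _ IH2|p i c s ps] t ht.
- eexists.
    by apply: (@ReachStep (Push i b)) => //; apply: ReachExit.
  move=> j; rewrite set_stackE act_on_tape; case: eqP => [->|ne].
    rewrite act_on_tape eqxx ffunE; exact: holds_stack_push.
  by rewrite act_on_tape; case: eqP => // _; apply: ht.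
- eexists; first exact: (@ReachExit (Pop i)).
  move=> j; rewrite set_stackE act_on_tape; case: eqP => [->|ne] //.
  exact: holds_stack_pop.
- have [t1 r1 h1] := IH1 _ ht; have [t2 r2 h2] := IH2 _ h1.
  by exists t2 => //; apply: reach_seql r1 r2.
- have [t1 r1 h1] := IH _ ht; exists t1 => //.
  apply: (@ReachStep (Ite p i c1 c2)); first by rewrite /= (holds_scan i ht) ps.
  by rewrite act_idle; apply: reach_itel.
- have [t1 r1 h1] := IH _ ht; exists t1 => //.
  apply: (@ReachStep (Ite p i c1 c2)).
    by rewrite /= (holds_scan i ht) (negbTE ps).
  by rewrite act_idle; apply: reach_iter.
- have [t1 r1 h1] := IH1 _ ht; have [t2 r2 h2] := IH2 _ h1.
  exists t2 => //; apply: (@ReachStep (While p i c)).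
    by rewrite /= (holds_scan i ht) ps.
  by rewrite act_idle; apply: reach_while r1 r2.
- exists t => //; rewrite -[X in reach _ _ _ X](act_idle t).
  by apply: (@ReachExit (While p i c)); rewrite /= (holds_scan i ht) (negbTE ps).
Qed.

(* The state [inr None] inspects the top of stack 0, and [inr (Some b)] halts
   with answer [b]. *)
Definition decider (c : cmd) : machine :=
  @Machine 3 void (ctrl c + option bool)%type (inl (entry c))
    (fun q => q == inr (Some true))
    (fun q r => match q with
       | inl q1 => let: (q', a) := trans q1 r in
                   Some (if q' is Some q1' then inl q1' else inr None, a)
       | inr None => Some (inr (Some (bit_of (r ord0) == Some true)), idle r)
       | inr (Some _) => None
       end).

Lemma decider_reach c (q : ctrl c) t n t' : reach q t n t' ->
  iter n (@tm_step (decider c)) (inl q, t) = (inr None, t').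
Proof.
elim=> [{}q {}t a e|{}q {}t q' a {}n {}t' e _ IH].
  by rewrite /= /tm_step /tm_next /= -/(scan t) e.
by rewrite iterSr -IH; congr iter; rewrite /tm_step /tm_next /= -/(scan t) e.
Qed.

Lemma decider_correct c w n s : exec c [:: w; [::]; [::]; [::]] n s ->
  let f := iter n.+1 (@tm_step (decider c)) (tm_init (decider c) w) in
  tm_halted f /\ tm_accept f.1 = (ohead (head [::] s) == Some true).
Proof.
move=> e; have h0 : holds (tm_init (decider c) w).2 [:: w; [::]; [::]; [::]].
  move=> i; rewrite ffunE; exists 0, 0; rewrite cats0.
  by case: i => [[|[|[|[|i]]]] ?] //=; case: w {e}.
have [t r h] := exec_reach e h0.
rewrite iterS (decider_reach r) /= /tm_step /tm_next /=.
rewrite -/(scan t) (holds_scan ord0 h) nth0 /tm_halted /=; split => //.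
by case: (_ == Some true).
Qed.

(** * Functions computable in polynomial time *)

Definition runs (c : cmd) (s s' : stacks) (N : nat) : Prop :=
  exists2 n, n <= N & exec c s n s'.

Lemma runs_seq c1 c2 s s1 s2 N1 N2 N :
  runs c1 s s1 N1 -> runs c2 s1 s2 N2 -> N1 + N2 <= N -> runs (c1 ;; c2) s s2 N.
Proof.
move=> [n1 l1 e1] [n2 l2 e2] l; exists (n1 + n2); first by lia.
exact: ExecSeq e1 e2.
Qed.

Lemma runs_then c1 c2 s s1 s2 N1 N2 :
  runs c1 s s1 N1 -> runs c2 s1 s2 N2 -> runs (c1 ;; c2) s s2 (N1 + N2).
Proof. by move=> h1 h2; apply: runs_seq h1 h2 _. Qed.

Lemma runs_le c s s' N N' : runs c s s' N -> N <= N' -> runs c s s' N'.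
Proof. by move=> [n l e] l'; exists n => //; lia. Qed.

Lemma runs_push i b s : runs (Push i b) s (set_stack s i (b :: stack s i)) 2.
Proof. by exists 2 => //; apply: ExecPush. Qed.

Lemma runs_pop i s : runs (Pop i) s (set_stack s i (behead (stack s i))) 1.
Proof. by exists 1 => //; apply: ExecPop. Qed.

Lemma runs_itet (p : option bool -> bool) i c1 c2 s s1 N :
  p (ohead (stack s i)) -> runs c1 s s1 N -> runs (Ite p i c1 c2) s s1 N.+1.
Proof. by move=> ps [n l e]; exists n.+1 => //; apply: ExecIteT. Qed.

Lemma runs_itef (p : option bool -> bool) i c1 c2 s s1 N :
  ~~ p (ohead (stack s i)) -> runs c2 s s1 N -> runs (Ite p i c1 c2) s s1 N.+1.
Proof. by move=> ps [n l e]; exists n.+1 => //; apply: ExecIteF. Qed.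

Lemma runs_whilet (p : option bool -> bool) i c s s1 s2 N1 N2 N :
  p (ohead (stack s i)) -> runs c s s1 N1 -> runs (While p i c) s1 s2 N2 ->
  N1 + N2 < N -> runs (While p i c) s s2 N.
Proof.
move=> ps [n1 l1 e1] [n2 l2 e2] l; exists (n1 + n2).+1; first by lia.
exact: ExecWhileT e1 e2.
Qed.

Lemma runs_whilef (p : option bool -> bool) i c s :
  ~~ p (ohead (stack s i)) -> runs (While p i c) s s 1.
Proof. by move=> ps; exists 1 => //; apply: ExecWhileF. Qed.

(** A step adds at most one bit. Hence results computed in polynomial time have polynomial size,
    which keeps compositions polynomial. *)
Lemma exec_size c s n s' : exec c s n s' ->
  size (flatten s') <= size (flatten s) + n.
Proof.
have set_size (t : stacks) i v :
    size (flatten (set_nth [::] t i v)) + size (nth [::] t i) =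
    size (flatten t) + size v.
  elim: t i => [|u t IH] [|i] /=; rewrite ?size_cat /=.
  - by lia.
  - by elim: i => [|i IH] /=; rewrite ?size_cat /=; lia.
  - by lia.
  - by have := IH i; lia.
elim=> {c s n s'} [i b s|i s| | | | |] *; try lia.
- by have := set_size s i (b :: stack s i) => /=; lia.
- by have := set_size s i (behead (stack s i)); rewrite size_behead; lia.
Qed.

Lemma runs_seq_pop c i s s1 s2 N :
  runs c s s1 N -> s2 = set_stack s1 i (behead (stack s1 i)) ->
  runs (c ;; Pop i) s s2 N.+1.
Proof. by move=> h ->; apply: runs_seq h (runs_pop _ _) _; rewrite addn1. Qed.

Definition rM : 'I_4 := @Ordinal 4 0 isT.
Definition rA : 'I_4 := @Ordinal 4 1 isT.
Definition rB : 'I_4 := @Ordinal 4 2 isT.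
Definition rC : 'I_4 := @Ordinal 4 3 isT.

Definition is_true_bit (o : option bool) : bool := o == Some true.
Definition is_false_bit (o : option bool) : bool := o == Some false.
Definition is_bit (o : option bool) : bool := isSome o.

Definition nop : cmd := While (fun _ => false) rM (Pop rM).

Lemma runs_nop s : runs nop s s 1.
Proof. exact: runs_whilef. Qed.

Definition main (m : seq bool) : stacks := [:: m; [::]; [::]; [::]].

Fixpoint pushes (l : seq bool) : cmd :=
  if l is x :: l' then pushes l' ;; Push rM x else nop.

Lemma runs_pushes l m : runs (pushes l) (main m) (main (l ++ m)) (2 * size l).+1.
Proof.
elim: l => [|x l IH]; first exact: runs_nop.
by apply: runs_seq IH (runs_push _ _ _) _; rewrite /=; lia.
Qed.

(** * Trees in prefix code and their handling on the stacks *)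

Inductive tree : Type := Leaf | Node of tree & tree.

Fixpoint ser (t : tree) : seq bool :=
  if t is Node a b then true :: ser a ++ ser b else [:: false].

Lemma ser_inj t t' r r' : ser t ++ r = ser t' ++ r' -> t = t' /\ r = r'.
Proof.
elim: t t' r r' => [|a IHa b IHb] [|a' b'] r r' //=; first by case.
by case; rewrite -!catA => /IHa [-> /IHb [-> ->]].
Qed.

Lemma size_ser_gt0 t : 0 < size (ser t).
Proof. by case: t. Qed.

Definition emit (da db b : bool) : cmd :=
  (if da then Push rA b else nop) ;; (if db then Push rB b else nop).

Definition move_loop (da db : bool) : cmd :=
  While is_bit rC
    (Ite is_true_bit rM (emit da db true ;; Push rC true)
                        (emit da db false ;; Pop rC) ;; Pop rM).

(* Removes the tree on top of the main stack, copying its code in reverse order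
   to stacks A and B according to the flags. Stack C counts the subtrees that
   are still to be read. *)
Definition move_tree (da db : bool) : cmd := Push rC true ;; move_loop da db.

Definition onto (d : bool) (l a : seq bool) : seq bool :=
  if d then catrev l a else a.

Lemma runs_emit da db x m a b c : runs (emit da db x) [:: m; a; b; c]
  [:: m; onto da [:: x] a; onto db [:: x] b; c] 4.
Proof.
apply: (@runs_seq _ _ _ [:: m; onto da [:: x] a; b; c] _ 2 2) => //.
  by case: da; [apply: runs_push | apply: runs_le (runs_nop _) _].
by case: db; [apply: runs_push | apply: runs_le (runs_nop _) _].
Qed.

(** The statement is relative to an arbitrary continuation from the state after the tree, so that
    the induction can pass through the left subtree and then the right one. A node replaces one
    pending subtree by two, and a leaf removes one. *)
Lemma runs_move_loop da db t m a b c s N :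
  runs (move_loop da db)
    [:: m; onto da (ser t) a; onto db (ser t) b; c] s N ->
  runs (move_loop da db) [:: ser t ++ m; a; b; true :: c] s (9 * size (ser t) + N).
Proof.
elim: t m a b c s N => [|t IHt u IHu] m a b c s N h /=.
  apply: (runs_whilet _ _ h (N1 := 8)) => //=.
  apply: runs_seq_pop; first (apply: (runs_itef _ (N := 6)) => //).
    apply: (runs_seq (N1 := 4) (N2 := 2)); [exact: runs_emit| |by []].
    by apply: runs_le (runs_pop _ _) _.
  by [].
apply: (runs_whilet (N1 := 8) (N2 := 9 * size (ser t ++ ser u) + N)) => //;
  last by rewrite /=; lia.
  apply: runs_seq_pop; first (apply: (runs_itet _ (N := 6)) => //).
    by apply: (runs_seq (N1 := 4) (N2 := 2));
      [exact: runs_emit | exact: runs_push | by []].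
  by [].
rewrite /= -catA size_cat mulnDr -addnA; apply: IHt; apply: IHu.
have onto_cat d l l' e : onto d (l ++ l') e = onto d l' (onto d l e).
  by case: d; rewrite //= catrev_catl.
by rewrite -!onto_cat.
Qed.

Lemma runs_move_tree da db t m a b :
  runs (move_tree da db) [:: ser t ++ m; a; b; [::]]
    [:: m; onto da (ser t) a; onto db (ser t) b; [::]] (12 * size (ser t)).
Proof.
apply: (runs_seq (N1 := 2)); first exact: runs_push.
  by apply: (runs_move_loop (N := 1)); apply: runs_whilef.
by have := size_ser_gt0 t; lia.
Qed.

Definition flush (i : 'I_4) : cmd :=
  While is_bit i (Ite is_true_bit i (Push rM true) (Push rM false) ;; Pop i).

Lemma runs_flushA m a b c :
  runs (flush rA) [:: m; a; b; c] [:: catrev a m; [::]; b; c] (5 * size a).+1.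
Proof.
elim: a m => [|x a IH] m; first exact: runs_whilef.
apply: (runs_whilet _ _ (IH (x :: m)) (N1 := 4)) => //=; last by lia.
apply: (@runs_seq_pop _ _ _ [:: x :: m; x :: a; b; c]); last by [].
by case: x; [apply: runs_itet|apply: runs_itef] => //; apply: runs_push.
Qed.

Lemma runs_flushB m a b c :
  runs (flush rB) [:: m; a; b; c] [:: catrev b m; a; [::]; c] (5 * size b).+1.
Proof.
elim: b m => [|x b IH] m; first exact: runs_whilef.
apply: (runs_whilet _ _ (IH (x :: m)) (N1 := 4)) => //=; last by lia.
apply: (@runs_seq_pop _ _ _ [:: x :: m; a; x :: b; c]); last by [].
by case: x; [apply: runs_itet|apply: runs_itef] => //; apply: runs_push.
Qed.

(** Moving a tree reverses its code and flushing restores it. In [swap] the first tree waits on A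
    and the second on B; as A is flushed first, the second tree ends on top. *)
Definition dup : cmd := move_tree true true ;; flush rA ;; flush rB.
Definition swap : cmd :=
  move_tree true false ;; move_tree false true ;; flush rA ;; flush rB.
Definition drop_tree : cmd := move_tree false false.

Lemma catrev_catrev (l m : seq bool) : catrev (catrev l [::]) m = l ++ m.
Proof. by rewrite !catrevE cats0 revK. Qed.

Lemma runs_dup t m : runs dup (main (ser t ++ m))
  (main (ser t ++ ser t ++ m)) (24 * size (ser t)).
Proof.
apply: (runs_seq (N1 := 12 * size (ser t))); first exact: runs_move_tree.
  apply: runs_seq; [exact: runs_flushA | | exact: leqnn].
  by rewrite /main -!catrev_catrev; apply: runs_flushB.
rewrite /= !catrevE !cats0 !size_rev; have := size_ser_gt0 t; lia.
Qed.

Lemma runs_swap t u m : runs swap (main (ser t ++ ser u ++ m))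
  (main (ser u ++ ser t ++ m)) (20 * (size (ser t) + size (ser u))).
Proof.
apply: (runs_seq (N1 := 12 * size (ser t))); first exact: runs_move_tree.
  apply: (runs_seq (N1 := 12 * size (ser u))); first exact: runs_move_tree.
    apply: runs_seq; [exact: runs_flushA | | exact: leqnn].
    by rewrite /main -!catrev_catrev; apply: runs_flushB.
  exact: leqnn.
rewrite /= !catrevE !cats0 !size_rev.
by have := size_ser_gt0 t; have := size_ser_gt0 u; lia.
Qed.

Lemma runs_drop t m :
  runs drop_tree (main (ser t ++ m)) (main m) (12 * size (ser t)).
Proof. exact: runs_move_tree. Qed.

(** * Polynomial bounds *)

Lemma leq_expl m n k : m <= n -> m ^ k <= n ^ k.
Proof. by case: k => // k; rewrite leq_exp2r. Qed.

(* Exponents absorb constant factors because the base is at least 2. *)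
Definition poly_bounded (T : Type) (m N : T -> nat) : Prop :=
  exists k, forall x, N x <= (m x).+2 ^ k.

Section PolyBounded.
Context {T : Type} {m : T -> nat}.
Implicit Types N : T -> nat.

Lemma poly_bounded_const c : poly_bounded m (fun _ => c).
Proof.
exists c => x; apply: leq_trans (ltnW (ltn_expl c (isT : 1 < 2))) _.
exact: leq_expl.
Qed.

Lemma poly_bounded_id : poly_bounded m m.
Proof. by exists 1 => x; rewrite expn1; lia. Qed.

Lemma poly_bounded_add N N' : poly_bounded m N -> poly_bounded m N' ->
  poly_bounded m (fun x => N x + N' x).
Proof.
(* For positive u and v, u + v is at most 2uv; the additional exponent pays for the factor 2. *)
move=> [j lj] [k lk]; exists (j + k).+1 => x; rewrite expnS expnD.
apply: leq_trans (leq_mul (isT : 2 <= (m x).+2) (leqnn _)).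
have : 0 < (m x).+2 ^ j by rewrite expn_gt0.
have : 0 < (m x).+2 ^ k by rewrite expn_gt0.
by have := lj x; have := lk x; nia.
Qed.

Lemma poly_bounded_mul N N' : poly_bounded m N -> poly_bounded m N' ->
  poly_bounded m (fun x => N x * N' x).
Proof.
by move=> [j lj] [k lk]; exists (j + k) => x; rewrite expnD leq_mul.
Qed.

Lemma poly_bounded_exp N k : poly_bounded m N ->
  poly_bounded m (fun x => N x ^ k).
Proof. by move=> [j lj]; exists (j * k) => x; rewrite expnM leq_expl. Qed.

Lemma poly_bounded_le N N' : poly_bounded m N' -> (forall x, N x <= N' x) ->
  poly_bounded m N.
Proof. by move=> [k lk] le; exists k => x; apply: leq_trans (le x) (lk x). Qed.

End PolyBounded.

(** * Data as trees *)

Class Enc (A : Type) := { te : A -> tree; te_inj : injective te }.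

Notation code a := (ser (te a)).
Notation tsize a := (size (code a)).

Fixpoint tree_of_seq (A : Type) (f : A -> tree) (l : seq A) : tree :=
  if l is a :: l' then Node (f a) (tree_of_seq f l') else Leaf.

Lemma te_bool_inj : injective (fun b : bool => if b then Node Leaf Leaf else Leaf).
Proof. by case; case. Qed.

Lemma te_pair_inj A B {eA : Enc A} {eB : Enc B} :
  injective (fun x : A * B => Node (te x.1) (te x.2)).
Proof. by move=> [a b] [a' b'] /= [ha hb]; rewrite (te_inj ha) (te_inj hb). Qed.

Lemma te_seq_inj A {eA : Enc A} : injective (tree_of_seq (@te A eA)).
Proof. by elim=> [|a l IH] [|a' l'] //= [ha hl]; rewrite (te_inj ha) (IH _ hl). Qed.

(** Horner evaluation recovers the number. The induction is on its logarithm, because halving drops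
    the lowest digit. *)
Lemma binary_digits_inj : injective binary_digits.
Proof.
pose value s := foldr (fun (b : bool) m => b + 2 * m) 0 s.
suff K : cancel binary_digits value by exact: can_inj K.
move=> n; rewrite /binary_digits.
have [k] := ubnP (trunc_log 2 n); elim: k n => // k IH n lk.
rewrite /= (iotaDl 1 0) -map_comp expn0 divn1.
case: (leqP n 1) => [|n_gt1]; first by case: n {lk} => [|[|]].
have e : trunc_log 2 n = (trunc_log 2 (n %/ 2)).+1.
  by rewrite trunc_log2S // divn2.
rewrite (_ : [seq _ | i <- _] = [seq odd (n %/ 2 %/ 2 ^ i) |
  i <- iota 0 (trunc_log 2 (n %/ 2)).+1]).
  by rewrite IH -?e // divn2 mul2n odd_double_half.
by rewrite e; apply: eq_map => i; rewrite /= -divnMA expnS.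
Qed.

Instance Enc_bool : Enc bool := {| te_inj := te_bool_inj |}.
Instance Enc_pair A B {eA : Enc A} {eB : Enc B} : Enc (A * B) :=
  {| te_inj := @te_pair_inj A B eA eB |}.
Instance Enc_seq A {eA : Enc A} : Enc (seq A) := {| te_inj := @te_seq_inj A eA |}.

Lemma te_nat_inj : injective (fun n => te (binary_digits n)).
Proof. by move=> m n e; apply/binary_digits_inj/te_inj/e. Qed.

Instance Enc_nat : Enc nat := {| te_inj := te_nat_inj |}.

Lemma tsize_pair A B {eA : Enc A} {eB : Enc B} (a : A) (b : B) :
  tsize (a, b) = (tsize a + tsize b).+1.
Proof. by rewrite /= size_cat. Qed.

Lemma tsize_cons A {eA : Enc A} (a : A) (l : seq A) :
  tsize (a :: l) = (tsize a + tsize l).+1.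
Proof. by rewrite /= size_cat. Qed.

(** * Closure properties of polynomial-time functions *)

Definition FP A B {eA : Enc A} {eB : Enc B} (f : A -> B) : Prop :=
  exists c N, poly_bounded (fun a => tsize a) N /\
    forall a m, runs c (main (code a ++ m)) (main (code (f a) ++ m)) (N a).

Lemma FP_tsize A B {eA : Enc A} {eB : Enc B} (f : A -> B) :
  FP f -> poly_bounded (fun a => tsize a) (fun a => tsize (f a)).
Proof.
move=> [c [N [pN h]]].
apply: (@poly_bounded_le _ _ _ (fun a => tsize a + N a)).
  by apply: poly_bounded_add => //; apply: poly_bounded_id.
move=> a; have [n ln /exec_size] := h a [::].
by rewrite /= !cats0; lia.
Qed.

Ltac poly := lazymatch goal with
  | |- poly_bounded _ (fun x => @?f x + @?g x) => apply: poly_bounded_add; poly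
  | |- poly_bounded _ (fun x => @?f x * @?g x) => apply: poly_bounded_mul; poly
  | |- poly_bounded _ (fun x => @?f x ^ _) => apply: poly_bounded_exp; poly
  | |- poly_bounded _ (fun _ => ?c) => exact: poly_bounded_const
  | _ => first [assumption | exact: poly_bounded_id | by apply: FP_tsize]
  end.

Section Closure.
Context {A : Type} {eA : Enc A}.

Notation pb := (@poly_bounded A (fun a => tsize a)).

(** The bound [N] depends on the value and not only on its size, so it is replaced by the power that
    dominates it before the size of [f a] is estimated. *)
Lemma poly_bounded_comp B {eB : Enc B} (f : A -> B) N :
  FP f -> poly_bounded (fun b => tsize b) N -> pb (fun a => N (f a)).
Proof.
move=> pf [k lk]; apply: (@poly_bounded_le _ _ _ (fun a => (tsize (f a) + 2) ^ k)).
  by poly.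
by move=> a; rewrite addn2.
Qed.

Lemma FP_ext B {eB : Enc B} (f g : A -> B) : f =1 g -> FP f -> FP g.
Proof.
by move=> fg [c [N [pN h]]]; exists c, N; split => // a m; rewrite -fg.
Qed.

(* Covers the constructors that the encoding identifies, such as consing a pair. *)
Lemma FP_recode B {eB : Enc B} (f : A -> B) : (forall a, te (f a) = te a) -> FP f.
Proof.
move=> ef; exists nop, (fun _ => 1); split; first exact: poly_bounded_const.
by move=> a m; rewrite ef; apply: runs_nop.
Qed.

Lemma FP_id : FP (fun a : A => a).
Proof. exact: FP_recode. Qed.

Lemma FP_const B {eB : Enc B} (b : B) : FP (fun _ : A => b).
Proof.
exists (drop_tree ;; pushes (code b)), (fun a => 12 * tsize a + (2 * tsize b).+1).
split; first by poly.
by move=> a m; apply: runs_seq; [exact: runs_drop|exact: runs_pushes|].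
Qed.

Lemma FP_comp B C {eB : Enc B} {eC : Enc C} (g : B -> C) (f : A -> B) :
  FP g -> FP f -> FP (fun a => g (f a)).
Proof.
move=> [cg [Ng [pg hg]]] pf; have [cf [Nf [pNf hf]]] := pf.
exists (cf ;; cg), (fun a => Nf a + Ng (f a)); split.
  exact: poly_bounded_add pNf (poly_bounded_comp pf pg).
by move=> a m; apply: runs_seq; [exact: hf | exact: hg |].
Qed.

Lemma FP_pair B C {eB : Enc B} {eC : Enc C} (f : A -> B) (g : A -> C) :
  FP f -> FP g -> FP (fun a => (f a, g a)).
Proof.
move=> pf pg; have [cf [Nf [pNf hf]]] := pf; have [cg [Ng [pNg hg]]] := pg.
(* The second component is computed first because it has to lie deeper; the final push supplies the
   node tag above both codes. *)
exists (dup ;; cg ;; swap ;; cf ;; Push rM true).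
exists (fun a => 24 * tsize a + Ng a + 20 * (tsize (g a) + tsize a) + Nf a + 2).
split; first by poly.
move=> a m; apply: runs_seq; [exact: runs_dup| |].
  apply: runs_then; [exact: hg|].
  apply: runs_then; [exact: runs_swap|].
  apply: runs_then; [exact: hf|].
  by have := runs_push rM true (main (code (f a) ++ code (g a) ++ m));
    rewrite /= -catA.
by lia.
Qed.

Lemma FP_fst B C {eB : Enc B} {eC : Enc C} (f : A -> B * C) :
  FP f -> FP (fun a => (f a).1).
Proof.
move=> pf; apply: (FP_comp (g := fst)) pf.
exists (Pop rM ;; swap ;; drop_tree), (fun z => 40 * tsize z); split; first by poly.
move=> [b c] m; rewrite tsize_pair /= -catA.
apply: runs_seq; [exact: runs_pop| |].
  by apply: runs_then; [exact: runs_swap|exact: runs_drop].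
by rewrite /=; lia.
Qed.

Lemma FP_snd B C {eB : Enc B} {eC : Enc C} (f : A -> B * C) :
  FP f -> FP (fun a => (f a).2).
Proof.
move=> pf; apply: (FP_comp (g := snd)) pf.
exists (Pop rM ;; drop_tree), (fun z => 13 * tsize z); split; first by poly.
move=> [b c] m; rewrite tsize_pair /= -catA.
apply: runs_seq; [exact: runs_pop|exact: runs_drop|].
by rewrite /=; lia.
Qed.

Lemma FP_if B {eB : Enc B} (b : A -> bool) (f g : A -> B) :
  FP b -> FP f -> FP g -> FP (fun a => if b a then f a else g a).
Proof.
move=> pb pf pg; have [c [N [pN h]]] := FP_pair pb FP_id.
have [cf [Nf [pNf hf]]] := pf; have [cg [Ng [pNg hg]]] := pg.
(* After the node tag of the pair comes the code of the boolean, three bits for [true] and one for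
   [false]; the pops remove exactly these. *)
exists (c ;; Pop rM ;;
  Ite is_true_bit rM (Pop rM ;; Pop rM ;; Pop rM ;; cf) (Pop rM ;; cg)).
exists (fun a => N a + (Nf a + Ng a + 6)); split; first by poly.
move=> a m; apply: runs_then; [exact: h|].
rewrite /= -catA; apply: (runs_seq (N1 := 1) (N2 := Nf a + Ng a + 5));
  [exact: runs_pop| |by lia].
case: (b a) => /=.
  apply: runs_le; first (apply: runs_itet => //; do 3
    (apply: runs_then; first exact: runs_pop); exact: hf).
  by lia.
apply: runs_le; first (apply: runs_itef => //;
  apply: runs_then; [exact: runs_pop|exact: hg]).
by lia.
Qed.

Lemma FP_match B C {eB : Enc B} {eC : Enc C} (l : A -> seq B)
    (f : A -> B -> seq B -> C) (g : A -> C) :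
  FP l -> FP (fun z : (B * seq B) * A => f z.2 z.1.1 z.1.2) -> FP g ->
  FP (fun a => if l a is x :: t then f a x t else g a).
Proof.
move=> pl [cf [Nf [pNf hf]]] [cg [Ng [pNg hg]]].
have pp := FP_pair pl FP_id; have [c [N [pN h]]] := pp.
have [k lk] := pNf.
(* A nonempty list has the same code as the pair of its head and tail, so pushing the tag back
   yields the code of [((x, t), a)]. *)
exists (c ;; Pop rM ;;
  Ite is_true_bit rM (Push rM true ;; cf) (Pop rM ;; cg)).
exists (fun a => N a + ((tsize (l a, a) + 2) ^ k + Ng a + 6)); split; first by poly.
move=> a m; apply: runs_then; [exact: h|].
have lNf x t : l a = x :: t -> Nf (x, t, a) <= (tsize (l a, a) + 2) ^ k.
  by move=> ->; have := lk (x, t, a); rewrite addn2.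
move: lNf; move: (_ ^ k) => K lNf; rewrite /= -catA.
apply: (runs_seq (N1 := 1) (N2 := K + Ng a + 5)); [exact: runs_pop| |by lia].
case: (l a) lNf => [|x t] lNf /=.
  apply: runs_le; first (apply: runs_itef => //;
    apply: runs_then; [exact: runs_pop|exact: hg]).
  by lia.
apply: runs_le; first (apply: runs_itet => //;
  apply: runs_then; first exact: runs_push).
  by have := hf (x, t, a) m; rewrite /= -catA; apply.
by have := lNf x t erefl; lia.
Qed.

(* Stack C records whether a mismatch has been found. *)
Definition compare : cmd :=
  While is_bit rA
    (Ite is_true_bit rA (Ite is_true_bit rB nop (Push rC true))
                        (Ite is_false_bit rB nop (Push rC true)) ;;
     Pop rB ;; Pop rA) ;;
  While is_bit rB (Push rC true ;; Pop rB).

(** The first loop matches [a] against a prefix of [b], a missing bit counting as a mismatch; the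
    second marks every leftover bit of [b]. The bound on [size c'] limits the cost of emptying stack
    C afterwards. *)
Lemma runs_compare m a b c : exists2 c',
  runs compare [:: m; a; b; c] [:: m; [::]; [::]; c'] (7 * size a + 4 * size b + 2) &
  size c' <= size c + size a + size b /\
  (c' == [::]) = (c == [::]) && (a == b).
Proof.
have [c1 h1 [s1 e1]] : exists2 c1, runs (While is_bit rA
    (Ite is_true_bit rA (Ite is_true_bit rB nop (Push rC true))
                        (Ite is_false_bit rB nop (Push rC true)) ;;
     Pop rB ;; Pop rA)) [:: m; a; b; c] [:: m; [::]; drop (size a) b; c1]
    (7 * size a + 1) &
  size c1 <= size c + size a /\
  (c1 == [::]) = (c == [::]) && (take (size a) b == a).
  elim: a b c => [|x a IH] b c.
    by exists c; [rewrite drop0; apply: runs_whilef|rewrite take0 eqxx andbT; lia].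
  pose ok := ohead b == Some x.
  have [c1 h1 [s1 e1]] := IH (behead b) (if ok then c else true :: c).
  exists c1; last first.
    split; first by move: s1; case: ifP => /= *; lia.
    rewrite e1 /ok; case: b {IH h1 e1 s1 ok} => [|y b] /=; first by rewrite andbF.
    by rewrite eqseq_cons (inj_eq Some_inj); case: (y == x); rewrite /= ?andbF.
  apply: (@runs_whilet _ _ _ _ [:: m; a; behead b; if ok then c else true :: c]
    _ 6 (7 * size a + 1)) => //=; last by lia.
    2: by have -> : drop (size a).+1 b = drop (size a) (behead b) by case: (b).
  apply: (@runs_seq _ _ _ [:: m; x :: a; b; if ok then c else true :: c] _ 4 2) => //.
    rewrite /ok; case: x {IH h1 e1 s1 ok}.
      apply: runs_itet => //; case: ifP => e.
        by apply: runs_itet; [rewrite /is_true_bit|apply: runs_le (runs_nop _) _].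
      by apply: runs_itef; [rewrite /is_true_bit /= e|apply: runs_push].
    apply: runs_itef => //; case: ifP => e.
      by apply: runs_itet; [rewrite /is_false_bit|apply: runs_le (runs_nop _) _].
    by apply: runs_itef; [rewrite /is_false_bit /= e|apply: runs_push].
  by apply: (@runs_then _ _ _ [:: _; _; _; _] _ 1 1); apply: runs_pop.
have h2 d c2 : runs (While is_bit rB (Push rC true ;; Pop rB))
    [:: m; [::]; d; c2] [:: m; [::]; [::]; catrev (nseq (size d) true) c2]
    (4 * size d + 1).
  elim: d c2 => [|y d IH] c2; first exact: runs_whilef.
  apply: (runs_whilet (N1 := 3)); [by []| |exact: (IH (true :: c2))|].
    by apply: (@runs_then _ _ _ [:: _; _; _; _] _ 2 1);
      [apply: runs_push|apply: runs_pop].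
  by rewrite /=; lia.
exists (catrev (nseq (size (drop (size a) b)) true) c1).
  by apply: runs_seq h1 (h2 _ _) _; rewrite size_drop; lia.
rewrite catrevE size_cat size_rev size_nseq size_drop; split; first by lia.
have <- : (take (size a) b == a) && (drop (size a) b == [::]) = (a == b).
  apply/andP/eqP => [[/eqP ea /eqP eb]|<-].
    by rewrite -(cat_take_drop (size a) b) ea eb cats0.
  by rewrite take_size drop_size.
rewrite andbA -e1 -size_drop.
case: (drop _ b) => [|y d]; rewrite ?andbT //= andbF.
by rewrite rev_cons cat_rcons; case: (rev _).
Qed.

End Closure.

(** The two codes are compared in reverse order. Reversal, [ser] and [te] being injective, equal bit
    strings mean equal values. *)
Lemma FP_eq (T : eqType) {eT : Enc T} A {eA : Enc A} (f g : A -> T) :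
  FP f -> FP g -> FP (fun a => f a == g a).
Proof.
move=> pf pg; apply: (FP_comp (g := fun z => z.1 == z.2)) (FP_pair pf pg).
pose clear := While is_bit rC (Pop rC).
have hclear c m : runs clear [:: m; [::]; [::]; c] (main m) (2 * size c + 1).
  elim: c => [|y c IH]; first exact: runs_whilef.
  apply: (runs_whilet (N1 := 1)); [by []|exact: runs_pop|exact: IH|].
  by rewrite /=; lia.
exists (Pop rM ;; move_tree true false ;; move_tree false true ;; compare ;;
  Ite is_bit rC (clear ;; pushes (code false)) (pushes (code true))).
exists (fun z => 40 * tsize z + 20); split; first by poly.
move=> [x y] m; rewrite tsize_pair /= -catA.
have [c h [s e]] := runs_compare m (catrev (code x) [::]) (catrev (code y) [::]) [::].
have {}e : (c == [::]) = (x == y).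
  rewrite e !catrevE !cats0 (inj_eq (can_inj revK)) /=; apply/eqP/eqP => [|-> //].
  by move=> exy; apply: te_inj; have [] := @ser_inj (te x) (te y) [::] [::];
    rewrite ?cats0.
have h' : runs (Ite is_bit rC (clear ;; pushes (code false)) (pushes (code true)))
    [:: m; [::]; [::]; c] (main (code (x == y) ++ m)) (2 * size c + 10).
  case: (x == y) e => [/eqP ->|nc].
    apply: runs_le; first by apply: runs_itef => //; apply: runs_pushes.
    by [].
  apply: runs_le; first (apply: runs_itet; last by
    apply: runs_then; [exact: hclear|exact: runs_pushes]).
    by case: (c) nc.
  by rewrite /=; lia.
apply: (runs_seq (N1 := 1)); [exact: runs_pop| |].
  apply: runs_then; first exact: runs_move_tree.
  apply: runs_then; first exact: runs_move_tree.
  exact: runs_then h h'.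
by move: s; rewrite !catrevE !cats0 !size_rev /=; lia.
Qed.

(** * Bounded iteration and list operations *)

Lemma runs_popM x m : runs (Pop rM) (main (x :: m)) (main m) 1.
Proof. exact: runs_pop. Qed.

(** The list [n e] serves as a unary counter. Repeating a polynomial-time step could double the size
    in every round, whence the polynomial bound on all intermediate values. The environment [e]
    travels with the value since each step reads it. *)
Lemma FP_iter E B X {eE : Enc E} {eB : Enc B} {eX : Enc X}
    (n : E -> seq X) (b : E -> B) (s : E -> B -> B) (N : E -> nat) :
  FP n -> FP b -> FP (fun z : E * B => s z.1 z.2) ->
  poly_bounded (fun e => tsize e) N ->
  (forall e i, tsize (iter i (s e) (b e)) <= N e) ->
  FP (fun e => iter (size (n e)) (s e) (b e)).
Proof.
move=> pn pb ps pN lN.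
have p0 : FP (fun e => (n e, (e, b e))).
  by apply: FP_pair => //; apply: FP_pair => //; apply: FP_id.
have p1 : FP (fun z : E * B => (z.1, s z.1 z.2)).
  by apply: FP_pair => //; apply: FP_fst; apply: FP_id.
have p2 : FP (fun z : E * B => z.2) by apply: FP_snd; apply: FP_id.
have [c0 [N0 [pN0 h0]]] := p0; have [c1 [N1 [[k lk] h1]]] := p1.
have [c2 [N2 [[k' lk'] h2]]] := p2.
pose loop := While is_true_bit rM (Pop rM ;; drop_tree ;; swap ;; c1 ;; swap).
(* [L] dominates the size of environment and value in every round, and [K] the cost of one round. *)
pose (L := fun e : E => tsize e + N e + 3).
pose (K := fun e : E => 12 * tsize (n e) + (20 * (tsize (n e) + L e) +
  (L e ^ k + 20 * (L e + tsize (n e)))) + 2).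
have hloop (e : E) (l : seq X) i m : tsize l <= tsize (n e) ->
    runs loop (main (code l ++ code (e, iter i (s e) (b e)) ++ m))
      (main (code (@nil X) ++ code (e, iter (i + size l) (s e) (b e)) ++ m))
      (size l * K e + 1).
  elim: l i => [|x l IH] i ll; first by rewrite addn0; apply: runs_whilef.
  have lL j : tsize (e, iter j (s e) (b e)) + 2 <= L e.
    by rewrite tsize_pair /L; have := lN e j; lia.
  move: ll; rewrite tsize_cons => ll.
  have {}IH := IH i.+1 ltac:(lia).
  rewrite -[size (x :: l)]/(size l).+1 addnS -addSn.
  apply: (@runs_whilet _ _ _ _ _ _ (1 + (12 * tsize x + (20 * (tsize l +
    tsize (e, iter i (s e) (b e))) + (N1 (e, iter i (s e) (b e)) +
    20 * (tsize (e, iter i.+1 (s e) (b e)) + tsize l))))) _ _ _ _ IH) => //.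
    apply: runs_then; first exact: (runs_popM true ((code x ++ code l) ++ _)).
    rewrite -catA; apply: runs_then; first exact: runs_drop.
    apply: runs_then; first exact: runs_swap.
    apply: runs_then; first exact: h1.
    exact: runs_swap.
  have l1 : N1 (e, iter i (s e) (b e)) <= L e ^ k.
    apply: leq_trans (lk _) _; apply: leq_expl; have := lL i; lia.
  by have := lL i; have := lL i.+1; rewrite mulSn /K; lia.
exists (c0 ;; Pop rM ;; loop ;; Pop rM ;; c2).
exists (fun e => N0 e + (tsize (n e) * K e + L e ^ k' + 4)).
split; first by rewrite /K /L; poly.
move=> e m; apply: runs_then; first exact: h0.
apply: runs_seq;
  first exact: (runs_popM true ((code (n e) ++ code (e, b e)) ++ m)).
  rewrite -catA; apply: runs_then; first exact: (hloop e (n e) 0 m (leqnn _)).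
  by apply: runs_then; [exact: runs_popM|exact: h2].
have l2 : N2 (e, iter (0 + size (n e)) (s e) (b e)) <= L e ^ k'.
  apply: leq_trans (lk' _) _; apply: leq_expl.
  by rewrite tsize_pair /L; have := lN e (0 + size (n e)); lia.
have : size (n e) <= tsize (n e).
  by elim: (n e) => // x l IH; rewrite tsize_cons ltnS (leq_trans IH) ?leq_addl.
by move=> /leq_mul /(_ (leqnn (K e))); move: l2; move: (size _ * _); lia.
Qed.

(** A fold is an iteration on pairs of remaining list and accumulator, with the list itself as the
    counter. *)
Lemma FP_foldl E B A {eE : Enc E} {eB : Enc B} {eA : Enc A}
    (l : E -> seq A) (b : E -> B) (s : E -> B -> A -> B) (N : E -> nat) :
  FP l -> FP b -> FP (fun z : E * B * A => s z.1.1 z.1.2 z.2) ->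
  poly_bounded (fun e => tsize e) N ->
  (forall e i, tsize (foldl (s e) (b e) (take i (l e))) <= N e) ->
  FP (fun e => foldl (s e) (b e) (l e)).
Proof.
move=> pl pb ps pN lN.
pose step e (z : seq A * B) := if z.1 is x :: t then (t, s e z.2 x) else z.
have stepE e i z : iter i (step e) z = (drop i z.1, foldl (s e) z.2 (take i z.1)).
  case: z => u c; elim: i u c => [|i IH] u c; first by rewrite drop0 take0.
  by rewrite iterSr; case: u => [|x u]; rewrite IH.
apply: (FP_ext (f := fun e => (iter (size (l e)) (step e) (l e, b e)).2)).
  by move=> e; rewrite stepE take_size.
apply: FP_snd; apply: (FP_iter (N := fun e => tsize (l e) + N e + 1)) => //.
- exact: FP_pair.
- apply: FP_match.
  + by apply: FP_fst; apply: FP_snd; apply: FP_id.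
  + apply: FP_pair; first by apply: FP_snd; apply: FP_fst; apply: FP_id.
    apply: (FP_comp ps (f := fun z : A * seq A * (E * (seq A * B)) =>
      (z.2.1, z.2.2.2, z.1.1))).
    do !apply: FP_pair; do ?(apply: FP_fst || apply: FP_snd); exact: FP_id.
  + by apply: FP_snd; apply: FP_id.
- by poly.
- move=> e i; rewrite stepE tsize_pair addn1 ltnS leq_add //=.
  elim: i (l e) => [|i IH] [|x t] //.
  by rewrite (leq_trans (IH t)) // tsize_cons ltnW // ltnS leq_addl.
Qed.

Ltac fp_env := lazymatch goal with
  | |- FP (fun z => z) => exact: FP_id
  | |- FP fst => exact: (FP_fst FP_id)
  | |- FP snd => exact: (FP_snd FP_id)
  | |- FP (fun _ => ?c) => exact: FP_const
  | |- FP (fun z => (@?f z).1) => apply: FP_fst; fp_env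
  | |- FP (fun z => (@?f z).2) => apply: FP_snd; fp_env
  | |- FP (fun z => (@?f z, @?g z)) => apply: FP_pair; fp_env
  | |- FP (fun z => @?f z == @?g z) => apply: FP_eq; fp_env
  | _ => idtac
  end.

Lemma FP_app2 E A B C {eE : Enc E} {eA : Enc A} {eB : Enc B} {eC : Enc C}
    (h : A -> B -> C) (f : E -> A) (g : E -> B) :
  FP (fun z : A * B => h z.1 z.2) -> FP f -> FP g -> FP (fun e => h (f e) (g e)).
Proof. by move=> ph pf pg; apply: (FP_comp ph (FP_pair pf pg)). Qed.

Lemma FP_and E {eE : Enc E} (f g : E -> bool) :
  FP f -> FP g -> FP (fun e => f e && g e).
Proof. by move=> pf pg; apply: FP_if => //; apply: FP_const. Qed.

Lemma FP_or E {eE : Enc E} (f g : E -> bool) :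
  FP f -> FP g -> FP (fun e => f e || g e).
Proof. by move=> pf pg; apply: FP_if => //; apply: FP_const. Qed.

Lemma FP_not E {eE : Enc E} (f : E -> bool) : FP f -> FP (fun e => ~~ f e).
Proof. by move=> pf; apply: FP_if => //; apply: FP_const. Qed.

Lemma FP_cons E A {eE : Enc E} {eA : Enc A}
    (f : E -> A) (g : E -> seq A) :
  FP f -> FP g -> FP (fun e => f e :: g e).
Proof.
by move=> pf pg; apply: (FP_comp _ (FP_pair pf pg) (g := fun z => z.1 :: z.2));
  apply: FP_recode.
Qed.

Lemma FP_has E A {eE : Enc E} {eA : Enc A}
    (p : E -> A -> bool) (l : E -> seq A) :
  FP (fun z : E * A => p z.1 z.2) -> FP l -> FP (fun e => has (p e) (l e)).
Proof.
move=> pp pl; apply: (FP_ext (f := fun e =>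
  foldl (fun b x => b || p e x) false (l e))).
  move=> e; rewrite -[RHS]orFb; elim: (l e) false => [|x t IH] b /=.
    by rewrite orbF.
  by rewrite IH orbA.
(* The accumulator is a boolean, whose code has at most three bits. *)
apply: (FP_foldl (N := fun _ => 3)) => //; first by fp_env.
- by apply: FP_or; fp_env; apply: (FP_app2 pp); fp_env.
- by poly.
- by move=> e i; case: (foldl _ _ _).
Qed.

Lemma FP_all E A {eE : Enc E} {eA : Enc A}
    (p : E -> A -> bool) (l : E -> seq A) :
  FP (fun z : E * A => p z.1 z.2) -> FP l -> FP (fun e => all (p e) (l e)).
Proof.
move=> pp pl; apply: (FP_ext (f := fun e => ~~ has (fun x => ~~ p e x) (l e))).
  by move=> e; rewrite has_predC negbK.
by apply/FP_not/FP_has => //; apply: FP_not.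
Qed.

Lemma tsize_catrev A {eA : Enc A} (s t : seq A) :
  tsize (catrev s t) + 1 = tsize s + tsize t.
Proof.
elim: s t => [|x s IH] t; first by rewrite /= addn1 add1n.
by rewrite -[catrev _ _]/(catrev s (x :: t)) IH !tsize_cons; lia.
Qed.

Lemma tsize_cat A {eA : Enc A} (s t : seq A) : tsize (s ++ t) + 1 = tsize s + tsize t.
Proof.
elim: s => [|x s IH]; first by rewrite /= addn1 add1n.
by rewrite cat_cons !tsize_cons; lia.
Qed.

Lemma tsize_take A {eA : Enc A} i (s : seq A) : tsize (take i s) <= tsize s.
Proof.
pose proof (tsize_cat (take i s) (drop i s)) as h.
pose proof (size_ser_gt0 (te (drop i s))).
by rewrite cat_take_drop in h; lia.
Qed.

Lemma FP_catrev E A {eE : Enc E} {eA : Enc A}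
    (f g : E -> seq A) : FP f -> FP g -> FP (fun e => catrev (f e) (g e)).
Proof.
move=> pf pg; apply: (FP_ext (f := fun e => foldl (fun t x => x :: t) (g e) (f e))).
  by move=> e; elim: (f e) (g e) => //= x s IH t; rewrite IH.
apply: (FP_foldl (N := fun e => tsize (f e) + tsize (g e))) => //.
- by apply: FP_cons; fp_env.
- by poly.
- move=> e i; have -> s t : foldl (fun t x => x :: t) t s = catrev s t.
    by elim: s t => //= x s IH t; rewrite IH.
  pose proof (tsize_catrev (take i (f e)) (g e)).
  by pose proof (tsize_take i (f e)); lia.
Qed.

Lemma tsize_filter A {eA : Enc A} (p : A -> bool) (s : seq A) :
  tsize (filter p s) <= tsize s.
Proof.
elim: s => // x s IH; rewrite tsize_cons [filter _ _]/=.
by case: ifP => _; rewrite ?tsize_cons; lia.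
Qed.

Lemma FP_filter E A {eE : Enc E} {eA : Enc A}
    (p : E -> A -> bool) (l : E -> seq A) :
  FP (fun z : E * A => p z.1 z.2) -> FP l -> FP (fun e => [seq x <- l e | p e x]).
Proof.
move=> pp pl.
have foldlE e s t : foldl (fun t x => if p e x then x :: t else t) t s =
    catrev [seq x <- s | p e x] t.
  by elim: s t => //= x s IH t; rewrite IH; case: ifP.
apply: (FP_ext (f := fun e => catrev
  (foldl (fun t x => if p e x then x :: t else t) [::] (l e)) [::])).
  by move=> e; rewrite foldlE !catrevE !cats0 revK.
apply: FP_catrev; last by fp_env.
apply: (FP_foldl (N := fun e => tsize (l e))) => //; first by fp_env.
- by apply: FP_if; fp_env; [apply: (FP_app2 pp); fp_env|apply: FP_cons; fp_env].
- by poly.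
- move=> e i; rewrite foldlE.
  pose proof (tsize_catrev [seq x <- take i (l e) | p e x] [::]) as h.
  pose proof (tsize_filter (fun x => p e x) (take i (l e))).
  pose proof (tsize_take i (l e)).
  have e0 : size (code (@nil A)) = 1 by [].
  by rewrite e0 in h; lia.
Qed.

Lemma FP_mem (T : eqType) {eT : Enc T} E {eE : Enc E} (f : E -> T) (l : E -> seq T) :
  FP f -> FP l -> FP (fun e => f e \in l e).
Proof.
move=> pf pl; apply: (FP_ext (f := fun e => has (fun x => x == f e) (l e))).
  by move=> e; rewrite has_pred1.
by apply: FP_has => //; fp_env; apply: (FP_comp pf); fp_env.
Qed.

(** * Inflationary fixed points *)

Section Inflation.
Context {A : eqType}.
Implicit Types (U S : seq A) (G : seq A -> A -> bool).

(** Filtering [U] keeps every iterate within the size of [U], and the disjunct [x \in S] makes the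
    iterates grow even where [G] is not monotone, as with [fires], whose conditions include
    consistency and the absence of active defaults of higher priority. *)
Definition inflate_step U G S : seq A := [seq x <- U | (x \in S) || G S x].

Definition inflate U G : seq A := iter (size U) (inflate_step U G) [::].

Lemma iter_inflate_filter U G i :
  exists p : pred A, iter i (inflate_step U G) [::] = [seq x <- U | p x].
Proof.
case: i => [|i]; first by exists pred0; rewrite filter_pred0.
by rewrite iterS; eexists.
Qed.

Lemma inflate_fixed U G : inflate_step U G (inflate U G) = inflate U G.
Proof.
pose S i := iter i (inflate_step U G) [::].
have mono i : S i = [seq x <- U | x \in S i].
  rewrite /S; have [p ->] := iter_inflate_filter U G i.
  by apply: eq_in_filter => x xU; rewrite mem_filter xU andbT.
have grow i : S i.+1 = S i \/ size (S i) < size (S i.+1).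
  have sub : subseq (S i) (S i.+1).
    rewrite /S iterS -/(S i) {1}mono /inflate_step -[X in subseq X _](_ :
      [seq x <- [seq x <- U | (x \in S i) || G (S i) x] | x \in S i] = _).
      exact: filter_subseq.
    rewrite -filter_predI; apply: eq_filter => x /=.
    by case: (x \in S i).
  by have := size_subseq_leqif sub => -[]; rewrite leq_eqVlt => /orP[|->];
    [move=> /eqP -> ; rewrite eqxx => /esym /eqP ->; left|right].
(* As long as the iterates change, each round adds an element; after more than [size U] rounds they
   would be longer than [U]. *)
have stop i : S i.+1 = S i \/ i < size (S i.+1).
  elim: i => [|i [e|IH]].
  - by case: (grow 0) => [|h]; [left|right; apply: leq_trans h].
  - by left; rewrite /S iterS -/(S i.+1) e.
  - by case: (grow i.+1) => [|h]; [left|right; apply: leq_ltn_trans h].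
case: (stop (size U)) => // h; move: (h).
by rewrite mono size_filter ltnNge count_size.
Qed.

Lemma inflate_ind U G (P : A -> Prop) :
  (forall S x, (forall y, y \in S -> P y) -> x \in U -> G S x -> P x) ->
  forall x, x \in inflate U G -> P x.
Proof.
move=> step; rewrite /inflate; elim: (size U) => [|i IH] x //=.
by rewrite mem_filter => /andP[/orP[/IH|]] // h xU; apply: step h.
Qed.

Lemma inflate_closed U G x : x \in U -> G (inflate U G) x -> x \in inflate U G.
Proof. by move=> xU Gx; rewrite -inflate_fixed mem_filter xU Gx orbT. Qed.

End Inflation.

Lemma FP_inflate E (A : eqType) {eE : Enc E} {eA : Enc A}
    (U : E -> seq A) (G : E -> seq A -> A -> bool) :
  FP U -> FP (fun z : E * seq A * A => G z.1.1 z.1.2 z.2) ->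
  FP (fun e => inflate (U e) (G e)).
Proof.
move=> pU pG.
apply: (@FP_iter _ _ _ _ _ _ U (fun _ => [::])
  (fun e => inflate_step (U e) (G e)) (fun e => tsize (U e))) => //; first by fp_env.
- apply: FP_filter; last by apply: (FP_comp pU); fp_env.
  by apply: FP_or; [apply: FP_mem; fp_env|apply: (FP_comp pG (f := fun z =>
    (z.1.1, z.1.2, z.2))); fp_env].
- by poly.
- by move=> e i; have [p ->] := iter_inflate_filter (U e) (G e) i; apply: tsize_filter.
Qed.

(** Up to [size U] rounds elements only accumulate, and afterwards nothing changes. Thus whatever
    holds by some stage can be read off the final one. *)
Lemma iter_inflate_sub (A : eqType) (U : seq A) (G : seq A -> A -> bool) i :
  {subset iter i (inflate_step U G) [::] <= inflate U G}.
Proof.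
have [le|le] := leqP i (size U); move=> x xi; last first.
  rewrite -(subnK (ltnW le)) iterD -/(inflate U G) in xi.
  by elim: (i - size U) xi => // j IH; rewrite iterS; 
    have -> : iter j (inflate_step U G) (inflate U G) = inflate U G;
    [elim: j {IH} => // j; rewrite iterS => ->; apply: inflate_fixed
    |rewrite inflate_fixed].
rewrite /inflate -(subnK le) iterD; elim: (_ - _) => // j IH.
rewrite iterS mem_filter IH /=.
have [p e] := iter_inflate_filter U G (j + i).
by move: IH; rewrite -iterD e mem_filter => /andP[].
Qed.

(** * The decision procedure *)

(** The tree code is written to stack A in reverse order, so that one flush delivers it to the main
    stack. Time and output size are linear in the input, and positivity of its size lets [K] absorb
    constant costs. *)
Definition transcodable X {eX : Enc X} (enc : X -> seq bool) : Prop :=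
  exists c K, forall x, [/\ 0 < size (enc x), tsize x <= K * size (enc x) &
    forall m a, runs c [:: enc x ++ m; a; [::]; [::]]
      [:: m; catrev (code x) a; [::]; [::]] (K * size (enc x))].

Lemma transcodable_bool : transcodable (fun b : bool => [:: b]).
Proof.
exists (Ite is_true_bit rM (Push rA true ;; Push rA false ;; Push rA false)
  (Push rA false) ;; Pop rM), 10 => b; split; [by []|by case: b|move=> m a].
apply: (@runs_seq _ _ _ [:: b :: m; catrev (code b) a; [::]; [::]] _ 7 1) => //;
  last exact: runs_pop.
case: b; last by apply: runs_le; first (by apply: runs_itef => //; apply: runs_push).
apply: runs_itet => //; apply: (@runs_then _ _ _ _ _ 2 4); first exact: runs_push.
by apply: (@runs_then _ _ _ _ _ 2 2); apply: runs_push.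
Qed.

Lemma transcodable_pair X Y {eX : Enc X} {eY : Enc Y} encX encY :
  @transcodable X eX encX -> @transcodable Y eY encY ->
  transcodable (fun z : X * Y => encX z.1 ++ encY z.2).
Proof.
move=> [c1 [K1 h1]] [c2 [K2 h2]].
exists (Push rA true ;; c1 ;; c2), (K1 + K2 + 2) => -[x y].
have [g1 s1 r1] := h1 x; have [g2 s2 r2] := h2 y.
rewrite size_cat -[(x, y).1]/x -[(x, y).2]/y.
have le1 : K1 * size (encX x) <= K1 * (size (encX x) + size (encY y)) by nia.
have le2 : K2 * size (encY y) <= K2 * (size (encX x) + size (encY y)) by nia.
split; [by lia|by rewrite tsize_pair; nia|move=> m a].
have -> : catrev (code (x, y)) a = catrev (code y) (catrev (code x) (true :: a)).
  by rewrite -catrev_catl.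
apply: (runs_seq (N1 := 2)); first exact: runs_push.
  apply: runs_then; first by rewrite -catA; apply: r1.
  exact: r2.
by nia.
Qed.

(** The bits by which [enc_seq] announces an element or the end of the list agree with the tags of
    [Node] and [Leaf], so they are copied and only the elements are converted. *)
Lemma transcodable_seq X {eX : Enc X} encX :
  @transcodable X eX encX -> transcodable (enc_seq encX).
Proof.
move=> [c [K h]].
pose loop := While is_true_bit rM (Pop rM ;; Push rA true ;; c).
(* The loop stops in front of the closing [false], so [a'] still lacks the leaf that ends the
   list. *)
have hloop (l : seq X) m a : exists2 a',
    runs loop [:: enc_seq encX l ++ m; a; [::]; [::]]
      [:: false :: m; a'; [::]; [::]] ((K + 4) * size (enc_seq encX l)) &
    false :: a' = catrev (code l) a.
  elim: l a => [|x l IH] a.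
    exists a => //; apply: runs_le; first exact: runs_whilef.
    by rewrite /= muln1 addn_gt0 orbT.
  have [g s r] := h x.
  have [a' r' e'] := IH (catrev (code x) (true :: a)).
  exists a'; last by rewrite e' -catrev_catl.
  apply: (runs_whilet (N1 := 3 + K * size (encX x))) r' _ => //.
    apply: (@runs_seq _ _ _ [:: encX x ++ enc_seq encX l ++ m; a; [::]; [::]] _ 1
      (2 + K * size (encX x))); last by lia.
      have -> : encX x ++ enc_seq encX l ++ m = (encX x ++ enc_seq encX l) ++ m
        by rewrite catA.
      by rewrite /enc_seq /= -!catA; apply: runs_pop.
    by apply: runs_then; [exact: runs_push|exact: r].
  by rewrite /enc_seq /= !size_cat /=; nia.
exists (loop ;; Pop rM ;; Push rA false), (K + 8) => l; split.
- by rewrite /enc_seq size_cat /= addn1.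
- elim: l => [|x l IH]; first by rewrite /enc_seq /=; lia.
  have [_ s _] := h x; move: IH; rewrite tsize_cons /enc_seq /= !size_cat /=; nia.
move=> m a; have [a' r <-] := hloop l m a.
apply: runs_seq r _ _; first by apply: runs_then; [exact: runs_pop|exact: runs_push].
by rewrite /enc_seq size_cat /=; nia.
Qed.

(** * The algorithm *)

Notation literal := (bool * nat)%type.
Notation clause := (seq literal).
Notation rule := (clause * clause)%type.
Notation input := (seq rule * (seq clause * (seq (rule * rule) * literal)))%type.

(** Nested pairs inherit a tree encoding, and their order follows [enc_instance], so that
    [enc_input (input_of I)] and [enc_instance I] are the same by computation. *)
Definition input_of (I : instance) : input :=
  (inst_defaults I, (inst_clauses I, (inst_prio I, inst_query I))).

Lemma transcodable_nat : transcodable enc_nat.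
Proof.
have [c [K h]] := transcodable_seq transcodable_bool.
by exists c, K => n; apply: h (binary_digits n).
Qed.

Definition enc_input (z : input) : seq bool :=
  enc_seq enc_default z.1 ++ enc_seq (enc_seq enc_lit) z.2.1 ++
  enc_seq (fun p => enc_default p.1 ++ enc_default p.2) z.2.2.1 ++
  enc_lit z.2.2.2.

Lemma transcodable_input : transcodable enc_input.
Proof.
have tlit : transcodable enc_lit.
  exact: transcodable_pair transcodable_bool transcodable_nat.
have tclause := transcodable_seq tlit.
have tdefault : transcodable enc_default := transcodable_pair tclause tclause.
have tprio := transcodable_seq (transcodable_pair tdefault tdefault).
exact: transcodable_pair (transcodable_seq tdefault)
  (transcodable_pair (transcodable_seq tclause)
    (transcodable_pair tprio tlit)).
Qed.

Definition neg (l : literal) : literal := (~~ l.1, l.2).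

Definition literals_in (s : seq clause) : clause :=
  foldl (fun u c => catrev c u) [::] s.

(** One step of unit propagation: a clause forces a literal once all its other literals are
    refuted. *)
Definition derivable (W : seq clause) (L S : clause) (l : literal) : bool :=
  (l \in L) ||
  has (fun c => (l \in c) && all (fun k => (k == l) || (neg k \in S)) c) W.

Definition propagate (W : seq clause) (L : clause) : clause :=
  inflate (catrev L (literals_in W)) (derivable W L).

Definition clash (W : seq clause) (S : clause) : bool :=
  has (fun l => neg l \in S) S || has (fun c => all (fun k => neg k \in S) c) W.

Definition refuted (W : seq clause) (L : clause) : bool :=
  clash W (propagate W L).

(* Unit propagation alone refutes all inconsistent Horn sets; branching once on
   each variable makes it complete for 2-literal clauses too. The literal [q]
   only ensures that there is a variable to branch on. *)
Definition unsat (W : seq clause) (q : literal) (L : clause) : bool :=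
  has (fun l => refuted W (l :: L) && refuted W (neg l :: L)) (q :: literals_in W).

Definition derives (W : seq clause) (q : literal) (L s : clause) : bool :=
  all (fun l => unsat W q (neg l :: L)) s.

Definition is_active (W : seq clause) (q : literal) (L : clause) (d : rule) : bool :=
  derives W q L d.1 && (~~ unsat W q (catrev d.2 L) && ~~ derives W q L d.2).

Definition conclusions (A : seq rule) : clause :=
  foldl (fun u d => catrev d.2 u) [::] A.

Definition fires (D : seq rule) (W : seq clause) (P : seq (rule * rule))
    (q : literal) (A : seq rule) (d : rule) : bool :=
  derives W q (conclusions A) d.1 && (~~ unsat W q (catrev d.2 (conclusions A)) &&
  ~~ has (fun d' => ((d', d) \in P) && is_active W q (conclusions A) d') D).

(** The query follows from the last stage exactly if its negation is inconsistent with the clauses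
    and the conclusions drawn. *)
Definition decide (z : input) : bool :=
  unsat z.2.1 z.2.2.2 (neg z.2.2.2 :: conclusions
    (inflate z.1 (fires z.1 z.2.1 z.2.2.1 z.2.2.2))).

(** * Running time of the algorithm *)

Ltac poly_time :=
  cbv beta;
  lazymatch goal with
  | |- FP (fun z => z) => exact: FP_id
  | |- FP fst => exact: (FP_fst FP_id)
  | |- FP snd => exact: (FP_snd FP_id)
  | |- FP (fun _ => ?c) => exact: FP_const
  | |- FP (fun z => (@?f z).1) => apply: FP_fst; poly_time
  | |- FP (fun z => (@?f z).2) => apply: FP_snd; poly_time
  | |- FP (fun z => (@?f z, @?g z)) => apply: FP_pair; poly_time
  | |- FP (fun z => @?f z == @?g z) => apply: FP_eq; poly_time
  | |- FP (fun z => @?f z :: @?g z) => apply: FP_cons; poly_time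
  | |- FP (fun z => catrev (@?f z) (@?g z)) => apply: FP_catrev; poly_time
  | |- FP (fun z => @?f z \in _) => apply: FP_mem; poly_time
  | |- FP (fun z => @?f z && @?g z) => apply: FP_and; poly_time
  | |- FP (fun z => @?f z || @?g z) => apply: FP_or; poly_time
  | |- FP (fun z => ~~ @?f z) => apply: FP_not; poly_time
  | |- FP (fun z => has (@?p z) (@?f z)) => apply: (FP_has (p := p)); poly_time
  | |- FP (fun z => all (@?p z) (@?f z)) => apply: (FP_all (p := p)); poly_time
  | pf : FP ?f |- FP ?f => exact: pf
  | pf : FP ?f |- FP (fun z => ?f (@?g z)) => apply: (FP_comp pf (f := g)); poly_time
  | |- _ => idtac
  end.

Section Algorithm.
Context {E : Type} {eE : Enc E}.

Lemma FP_neg (f : E -> literal) : FP f -> FP (fun e => neg (f e)).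
Proof. by move=> pf; rewrite /neg; poly_time. Qed.

(** The size condition on [g] keeps the accumulated list within the size of the part of the input
    already consumed. *)
Lemma FP_flatten_rev X {eX : Enc X} (g : X -> clause) (f : E -> seq X) :
  FP g -> FP f -> (forall x, tsize (g x) <= tsize x) ->
  FP (fun e => foldl (fun u x => catrev (g x) u) [::] (f e)).
Proof.
move=> pg pf lg; apply: (FP_foldl (N := fun e => tsize (f e))) => //.
- by poly_time.
- by poly_time.
- by poly.
move=> e i; apply: leq_trans (tsize_take i _).
have le (s : seq X) (u : clause) :
    tsize (foldl (fun u x => catrev (g x) u) u s) + 1 <= tsize s + tsize u.
  elim: s u => [|x s IH] u; first by rewrite add1n addn1.
  rewrite tsize_cons; apply: leq_trans (IH (catrev (g x) u)) _.
  by pose proof (tsize_catrev (g x) u); pose proof (lg x); lia.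
have e0 : tsize ([::] : clause) = 1 by [].
by have := le (take i (f e)) [::]; rewrite e0 leq_add2r.
Qed.

Lemma FP_literals_in (f : E -> seq clause) : FP f -> FP (fun e => literals_in (f e)).
Proof. by move=> pf; apply: FP_flatten_rev => //; apply: FP_id. Qed.

Lemma FP_conclusions (f : E -> seq rule) : FP f -> FP (fun e => conclusions (f e)).
Proof.
move=> pf; apply: (FP_flatten_rev (g := snd)) => //; first by poly_time.
by case=> a b; rewrite tsize_pair -[(a, b).2]/b; lia.
Qed.

End Algorithm.

Lemma FP_derivable E {eE : Enc E} (W : E -> seq clause) (L S : E -> clause)
    (l : E -> literal) : FP W -> FP L -> FP S -> FP l ->
  FP (fun e => derivable (W e) (L e) (S e) (l e)).
Proof.
move=> pW pL pS pl; rewrite /derivable; poly_time.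
by apply: FP_neg; poly_time.
Qed.

Lemma FP_propagate E {eE : Enc E} (W : E -> seq clause) (L : E -> clause) :
  FP W -> FP L -> FP (fun e => propagate (W e) (L e)).
Proof.
move=> pW pL; apply: (FP_inflate (G := fun e => derivable (W e) (L e))).
  by apply: FP_catrev => //; apply: FP_literals_in.
by apply: FP_derivable; poly_time.
Qed.

Lemma FP_clash E {eE : Enc E} (W : E -> seq clause) (S : E -> clause) :
  FP W -> FP S -> FP (fun e => clash (W e) (S e)).
Proof.
by move=> pW pS; rewrite /clash; poly_time; apply: FP_neg; poly_time.
Qed.

Lemma FP_refuted E {eE : Enc E} (W : E -> seq clause) (L : E -> clause) :
  FP W -> FP L -> FP (fun e => refuted (W e) (L e)).
Proof. by move=> pW pL; apply: FP_clash => //; apply: FP_propagate. Qed.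

Lemma FP_unsat E {eE : Enc E} (W : E -> seq clause) (q : E -> literal)
    (L : E -> clause) :
  FP W -> FP q -> FP L -> FP (fun e => unsat (W e) (q e) (L e)).
Proof.
move=> pW pq pL; rewrite /unsat; poly_time; last exact: FP_literals_in.
all: apply: FP_refuted; poly_time; by apply: FP_neg; poly_time.
Qed.

Lemma FP_derives E {eE : Enc E} (W : E -> seq clause) (q : E -> literal)
    (L s : E -> clause) :
  FP W -> FP q -> FP L -> FP s -> FP (fun e => derives (W e) (q e) (L e) (s e)).
Proof.
move=> pW pq pL ps; rewrite /derives; poly_time.
by apply: FP_unsat; poly_time; apply: FP_neg; poly_time.
Qed.

Lemma FP_fires E {eE : Enc E} (D : E -> seq rule) (W : E -> seq clause)
    (P : E -> seq (rule * rule)) (q : E -> literal) (A : E -> seq rule)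
    (d : E -> rule) :
  FP D -> FP W -> FP P -> FP q -> FP A -> FP d ->
  FP (fun e => fires (D e) (W e) (P e) (q e) (A e) (d e)).
Proof.
move=> pD pW pP pq pA pd.
rewrite /fires /is_active; poly_time;
  first [apply: FP_unsat|apply: FP_derives]; poly_time;
  by apply: FP_conclusions; poly_time.
Qed.

Lemma FP_decide : FP decide.
Proof.
rewrite /decide; apply: FP_unsat; poly_time; first by apply: FP_neg; poly_time.
apply: FP_conclusions.
apply: (FP_inflate (U := fun z => z.1)
  (G := fun z : input => fires z.1 z.2.1 z.2.2.1 z.2.2.2)); first by poly_time.
by apply: FP_fires; poly_time.
Qed.

(** * Correctness *)

Definition sat_lit (v : nat -> bool) (l : literal) : bool := v l.2 == l.1.

Definition models (v : nat -> bool) (W : seq clause) (L : clause) : bool :=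
  all (has (sat_lit v)) W && all (sat_lit v) L.

Lemma sat_neg v l : sat_lit v (neg l) = ~~ sat_lit v l.
Proof. by rewrite /sat_lit /=; case: (v _); case: l.1. Qed.

Lemma mem_literals_in (l : literal) (W : seq clause) : 
  (l \in literals_in W) = has (fun c => l \in c) W.
Proof.
rewrite /literals_in -[RHS]orbF -[false]/(l \in [::]); elim: W [::] => //= c W IH u.
by rewrite IH catrevE mem_cat mem_rev orbA [_ || (l \in c)]orbC -!orbA.
Qed.

Lemma mem_conclusions (l : literal) (A : seq rule) : 
  (l \in conclusions A) = has (fun d : rule => l \in d.2) A.
Proof.
rewrite /conclusions -[RHS]orbF -[false]/(l \in [::]); elim: A [::] => //= c A IH u.
by rewrite IH catrevE mem_cat mem_rev orbA [_ || (l \in c.2)]orbC -!orbA.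
Qed.

Lemma mem_catrev (T : eqType) (x : T) s t :
  (x \in catrev s t) = (x \in s) || (x \in t).
Proof. by rewrite catrevE mem_cat mem_rev. Qed.

Lemma propagateL W (L : clause) l : l \in L -> l \in propagate W L.
Proof.
by move=> lL; apply: inflate_closed; rewrite ?mem_catrev /derivable ?lL.
Qed.

Lemma propagate_unit (W : seq clause) (L c : clause) (l : literal) :
  c \in W -> l \in c ->
  (forall k, k \in c -> k != l -> neg k \in propagate W L) ->
  l \in propagate W L.
Proof.
move=> cW lc h; apply: inflate_closed.
  by rewrite mem_catrev mem_literals_in; apply/orP; right; apply/hasP; exists c.
apply/orP; right; apply/hasP; exists c => //; rewrite lc.
by apply/allP => k kc; case: eqP => //= /eqP; apply: h.
Qed.

Lemma propagate_ind (W : seq clause) (L : clause) (P : literal -> Prop) :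
  (forall l, l \in L -> P l) ->
  (forall c l, c \in W -> l \in c ->
     (forall k, k \in c -> k != l -> P (neg k)) -> P l) ->
  forall l, l \in propagate W L -> P l.
Proof.
move=> hL hW; apply: inflate_ind => S l hS _ /orP[/hL //|/hasP[c cW /andP[lc h]]].
apply: (hW c) => // k kc kl; apply: hS.
by have := allP h k kc; rewrite (negbTE kl).
Qed.

Lemma propagate_mono (W W' : seq clause) (L L' : clause) :
  {subset W <= W'} -> {subset L <= L'} ->
  {subset propagate W L <= propagate W' L'}.
Proof.
move=> sW sL; apply: propagate_ind => [l /sL /propagateL|c l /sW cW lc h]; first exact.
exact: propagate_unit cW lc h.
Qed.

(** More clauses and literals only enlarge what is propagated. This carries refutations from the
    untouched clauses back to the whole set. *)
Lemma refuted_mono (W W' : seq clause) (L L' : clause) :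
  {subset W <= W'} -> {subset L <= L'} ->
  refuted W L -> refuted W' L'.
Proof.
move=> sW sL; have sP := propagate_mono sW sL.
case/orP => /hasP[x xin h]; apply/orP; [left|right]; apply/hasP; exists x.
- exact: sP.
- exact: sP.
- exact: sW.
- by apply/allP => k /(allP h) /sP.
Qed.

(** Every propagated literal is true in every model, so a clash would make a literal both true and
    false, or a clause false. *)
Lemma refuted_sound v W L : models v W L -> ~~ refuted W L.
Proof.
move=> /andP[mW mL].
have hP l : l \in propagate W L -> sat_lit v l.
  move: l; apply: propagate_ind => [l /(allP mL) //|c l cW lc h].
  have [k kc sk] := hasP (allP mW c cW).
  case: (eqVneq k l) => [<- //|kl].
  by have := h k kc kl; rewrite sat_neg sk.
apply/negP => /orP[] /hasP[x xin].
- by move=> /hP; rewrite sat_neg hP.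
- have [k kx sk] := hasP (allP mW x xin).
  by move=> /allP /(_ k kx) /hP; rewrite sat_neg sk.
Qed.

(** A model satisfies one of the two branching literals, and the corresponding branch is then not
    refuted. *)
Lemma unsat_sound v W q L : models v W L -> ~~ unsat W q L.
Proof.
move=> /andP[mW mL]; apply/negP => /hasP[l _ /andP[r1 r2]].
case: (boolP (sat_lit v l)) => sl.
  by move: r1; apply/negP/(@refuted_sound v)/andP; rewrite /= sl.
by move: r2; apply/negP/(@refuted_sound v)/andP; rewrite /= sat_neg sl.
Qed.

(** The model makes true exactly the propagated atoms. In a false clause all negative literals would
    be refuted by propagation; a positive literal, being the only one, would then be propagated and
    true, and without one there is a clash. *)
Lemma horn_complete W L : all horn W -> ~~ refuted W L -> exists v, models v W L.
Proof.
move=> hW; rewrite /refuted negb_or => /andP[/hasPn cons /hasPn ncl].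
exists (fun x => (true, x) \in propagate W L); apply/andP; split; last first.
  apply/allP => -[[] x] /(propagateL W) lS; rewrite /sat_lit /= ?lS //.
  by have := cons _ lS; rewrite /neg /= => /negbTE ->.
apply/allP => c cW; apply/negPn/negP => /hasPn nc.
have nneg k : k \in c -> k.1 = false -> neg k \in propagate W L.
  case: k => [[] x] // /nc; rewrite /sat_lit /= /neg /=.
  by case: (_ \in _).
have /negP[] := ncl c cW; apply/allP => k kc.
case kpos : k.1; last exact: nneg.
have /nc : k \in c by [].
rewrite /sat_lit kpos -[in (true, _)]kpos -surjective_pairing eqb_id => /negP[].
apply: (propagate_unit cW kc) => k' k'c ne; apply: nneg => //.
apply/negbTE/negP => k'pos.
have /allP /(_ c cW) := hW; rewrite /horn leqNgt => /negP[].
have : {subset [:: k; k'] <= [seq l <- c | l.1]}.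
  by move=> l; rewrite !inE mem_filter => /orP[] /eqP ->; rewrite ?kpos ?k'pos ?kc ?k'c.
move=> /uniq_leq_size; rewrite /= inE eq_sym ne size_filter; exact.
Qed.

(** Propagated literals fix the values of their variables and [v'] gives the rest. A touched clause
    contains a propagated literal, or one literal is refuted and the other is propagated; an
    untouched clause has only free variables. *)
Lemma two_literal_extend W L v' : all two_literal W -> ~~ refuted W L ->
  all (has (sat_lit v'))
    [seq c <- W | ~~ has (fun l =>
      (l \in propagate W L) || (neg l \in propagate W L)) c] ->
  exists v, models v W L.
Proof.
move=> h2; rewrite /refuted negb_or; set S := propagate W L => /andP[/hasPn cons _] m'.
exists (fun x => if (true, x) \in S then true
  else if (false, x) \in S then false else v' x).
have satS l : l \in S -> sat_lit (fun x => if (true, x) \in S then true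
    else if (false, x) \in S then false else v' x) l.
  case: l => [[] x] lS; rewrite /sat_lit /= ?lS //.
  by have := cons _ lS; rewrite /neg /= => /negbTE ->.
apply/andP; split; last by apply/allP => l /propagateL /satS.
apply/allP => c cW.
case: (boolP (has (fun l => (l \in S) || (neg l \in S)) c)); last first.
  move=> nt; have /allP /(_ c) := m'; rewrite mem_filter nt cW.
  move=> /(_ isT) /hasP[l lc sl].
  apply/hasP; exists l => //; move: sl; have := hasPn nt l lc.
  rewrite negb_or /sat_lit; case: l {lc} => [[] x] /= /andP[/negbTE e1 /negbTE e2];
  by move: e1 e2; rewrite /neg /= => -> ->.
case/hasP => l lc /orP[lS|nlS]; first by apply/hasP; exists l => //; apply: satS.
have /allP /(_ c cW) := h2; move: cW lc; rewrite /two_literal.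
case: c => [|a [|b [|]]] // cW lc _.
(* [k] is the partner of the refuted literal [l]. If the two coincide, the clause forces [k]
   outright. *)
have [k [kc ek]] : exists k, k \in [:: a; b] /\
    forall k', k' \in [:: a; b] -> k' != k -> k' = l.
  move: lc; rewrite !inE => /orP[] /eqP ->; [exists b|exists a];
    rewrite !inE eqxx ?orbT; split => // k'; rewrite !inE => /orP[] /eqP -> //;
    by rewrite eqxx.
apply/hasP; exists k => //; apply: satS; apply: (propagate_unit cW kc) => k' k'c ne.
by rewrite (ek _ k'c ne).
Qed.

(** Induction on the number of clauses: a harmless value for a variable of the first clause is
    propagated, and the untouched clauses inherit the hypothesis by monotonicity. *)
Lemma two_literal_complete (W : seq clause) : all two_literal W ->
  (forall l, l \in literals_in W -> ~~ refuted W [:: l] \/ ~~ refuted W [:: neg l]) ->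
  exists v, all (has (sat_lit v)) W.
Proof.
have [n] := ubnP (size W); elim: n W => // n IH [|c W] lW h2 hr; first by exists xpred0.
have [a [b cE]] : exists a b, c = [:: a; b].
  move: h2; rewrite /= /two_literal; case: c {lW hr} => [|a [|b [|]]] //= _.
  by exists a, b.
have [m [em hm]] : exists m, (m = a \/ m = neg a) /\ ~~ refuted (c :: W) [:: m].
  have : a \in literals_in (c :: W) by rewrite mem_literals_in /= cE !inE eqxx.
  by move/hr => [] h; [exists a|exists (neg a)]; split => //; [left|right].
set W' := [seq x <- c :: W | ~~ has (fun l =>
  (l \in propagate (c :: W) [:: m]) || (neg l \in propagate (c :: W) [:: m])) x].
have sW' : {subset W' <= c :: W} by move=> x; rewrite mem_filter => /andP[].
have [v' hv'] : exists v, all (has (sat_lit v)) W'.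
  apply: IH.
  - rewrite -ltnS; apply: leq_trans lW; rewrite !ltnS /W' /=.
    (* The first clause is touched because it contains the variable of [m]; hence [W'] is smaller
       than [c :: W]. *)
    have -> : has (fun l => (l \in propagate (c :: W) [:: m]) ||
        (neg l \in propagate (c :: W) [:: m])) c.
      apply/hasP; exists a; first by rewrite cE inE eqxx.
      have := @propagateL (c :: W) [:: m] m; rewrite inE eqxx => /(_ isT).
      by case: em => -> ->; rewrite ?orbT.
    by rewrite /= size_filter count_size.
  - by apply/allP => x /sW'; apply/allP.
  - move=> l; rewrite mem_literals_in => /hasP[x /sW' xW lx].
    have /hr : l \in literals_in (c :: W).
      by rewrite mem_literals_in; apply/hasP; exists x.
    by case=> h; [left|right]; apply: contra h; apply: refuted_mono.
by have [v /andP[hv _]] := two_literal_extend h2 hm hv'; exists v.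
Qed.

(** An unrefuted branch on [q] gives a set [L'] containing [L]. It suffices for Horn clauses; for
    2-literal clauses the tests on the other variables show that the clauses untouched by [L'] are
    satisfiable. *)
Lemma unsat_complete W q L : all horn W || all two_literal W ->
  ~~ unsat W q L -> exists v, models v W L.
Proof.
move=> hW /hasPn h.
have hq := h q (mem_head _ _).
have [L' sL hL'] : exists2 L', {subset L <= L'} & ~~ refuted W L'.
  move: hq; rewrite negb_and => /orP[] hq; [exists (q :: L)|exists (neg q :: L)] => //;
    by move=> x; rewrite inE orbC => ->.
suff [v /andP[mW mL]] : exists v, models v W L'.
  by exists v; apply/andP; split => //; apply/allP => l /sL; apply/allP.
case/orP: hW => [hW|h2]; first exact: horn_complete.
set W' := [seq x <- W | ~~ has (fun l =>
  (l \in propagate W L') || (neg l \in propagate W L')) x].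
have sW' : {subset W' <= W} by move=> x; rewrite mem_filter => /andP[].
have [v' hv'] : exists v, all (has (sat_lit v)) W'.
  apply: two_literal_complete; first by apply/allP => x /sW'; apply/allP.
  move=> l; rewrite mem_literals_in => /hasP[x /sW' xW lx].
  have : l \in q :: literals_in W.
    by rewrite inE mem_literals_in; apply/orP; right; apply/hasP; exists x.
  move/h; rewrite negb_and => /orP[] hl; [left|right]; apply: contra hl;
    apply: refuted_mono => // y; rewrite !inE => /eqP ->; by rewrite eqxx.
exact: two_literal_extend hv'.
Qed.

Lemma unsatP W q L : all horn W || all two_literal W ->
  reflect (forall v, ~~ models v W L) (unsat W q L).
Proof.
move=> hW; apply: (iffP idP) => [u v|h].
  by apply/negP => /(unsat_sound q); rewrite u.
by apply/negPn/negP => /(unsat_complete hW) [v]; apply/negP.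
Qed.

(** * Formulae and defaults as lists of literals *)

Lemma eval_lit v l : eval v (lit_form l) = sat_lit v l.
Proof. by case: l => [[] x]; rewrite /sat_lit /=; case: (v x). Qed.

Lemma eval_conj v s : eval v (conj_form s) = all (sat_lit v) s.
Proof.
elim: s => [|l [|k s] IH] //; first by rewrite /= andbT eval_lit.
by rewrite [LHS]/= eval_lit -[eval _ _]/(eval v (conj_form (k :: s))) IH.
Qed.

Lemma eval_clause v s : eval v (clause_form s) = has (sat_lit v) s.
Proof.
elim: s => [|l [|k s] IH] //; first by rewrite /= orbF eval_lit.
by rewrite [LHS]/= eval_lit -[eval _ _]/(eval v (clause_form (k :: s))) IH.
Qed.

Lemma lit_form_inj : injective lit_form.
Proof. by move=> [[] x] [[] y] //= [->]. Qed.

(** A conjunction of one literal is the bare literal, which has to be told apart from [Top] and from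
    [And]. Injectivity lets membership of defaults and priorities be tested on the lists of the
    instance. *)
Lemma conj_form_inj : injective conj_form.
Proof.
have nlit l (f g : form) : lit_form l <> And f g by case: l => [[] x].
have ntop l : lit_form l <> Top by case: l => [[] x].
elim=> [|l [|k s] IH] [|l' [|k' s']] //=.
- by move=> /esym /ntop.
- by move=> /ntop.
- by move=> /lit_form_inj ->.
- by move=> /nlit.
- by move=> /esym /nlit.
- by case=> /lit_form_inj -> /(IH (k' :: s')) ->.
Qed.

Lemma default_form_inj : injective default_form.
Proof.
by move=> [a b] [a' b'] [/conj_form_inj -> /conj_form_inj ->].
Qed.

Lemma strict_total_order_maximal D P T :
  strict_total_order D P -> strict_total_order D T -> (P `<=` T)%classic -> T = P.
Proof.
move=> [_ totP] [[TD irrT transT] _] PT; apply/seteqP; split => // -[a b] Tab.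
have [Da Db] := TD _ _ Tab.
have neq : a <> b by move=> e; rewrite e in Tab; apply: irrT Tab.
have [//|Pba] := totP _ _ Da Db neq.
by case: (irrT a); apply: transT Tab (PT _ Pba).
Qed.

(** * Stages of the extension and rounds of the algorithm *)

Section Stages.
Context (I : instance) (valid : valid_instance I).

Local Notation D := (inst_defaults I).
Local Notation W := (inst_clauses I).
Local Notation P := (inst_prio I).
Local Notation q := (inst_query I).
Local Notation stage_form := (stage (inst_D I) (inst_W I) (inst_P I)).

Definition applied (i : nat) : seq rule :=
  iter i (inflate_step D (fires D W P q)) [::].

(** Equality of models is all that entailment sees, so every test on the formulae in [S] becomes a
    satisfiability test on [W] and the literals in [L]. *)
Definition theory_of (S : set form) (L : clause) : Prop :=
  forall v, (forall g, S g -> eval v g) <-> models v W L.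

Lemma clausesP : all horn W || all two_literal W.
Proof. by case: valid. Qed.

Lemma entails_conj S L s : theory_of S L ->
  entails S (conj_form s) <-> derives W q L s.
Proof.
move=> hS; split=> [h|/allP h v /hS m].
  apply/allP => l ls; apply/(unsatP _ _ clausesP) => v; apply/negP => /andP[mW /=].
  move=> /andP[nl mL]; have /h : forall g, S g -> eval v g by apply/hS/andP.
  by rewrite eval_conj => /allP /(_ l ls); apply/negP; rewrite -sat_neg.
rewrite eval_conj; apply/allP => l /h /(unsatP _ _ clausesP) /(_ v).
by move: m => /andP[mW mL]; rewrite /models mW /= mL sat_neg andbT negbK.
Qed.

Lemma entails_not_conj S L s : theory_of S L ->
  entails S (Not (conj_form s)) <-> unsat W q (catrev s L).
Proof.
have allE v : all (sat_lit v) (catrev s L) = all (sat_lit v) s && all (sat_lit v) L.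
  by rewrite catrevE all_cat all_rev.
move=> hS; split=> [h|/(unsatP _ _ clausesP) h v /hS /andP[mW mL]].
  apply/(unsatP _ _ clausesP) => v; apply/negP => /andP[mW].
  rewrite allE => /andP[ms mL].
  have /h : forall g, S g -> eval v g by apply/hS/andP.
  by rewrite /= eval_conj ms.
by have := h v; rewrite /models mW allE mL andbT /= eval_conj.
Qed.

Lemma active_rule S L d : theory_of S L ->
  active S (default_form d) <-> is_active W q L d.
Proof.
move=> hS; rewrite /is_active; split.
  move=> [/(entails_conj _ hS) h0 h1 h2].
  apply/and3P; split => //; apply/negP.
    by move=> /(entails_not_conj _ hS).
  by move=> /(entails_conj _ hS).
move=> /and3P[/(entails_conj _ hS) h0 /negP h1 /negP h2]; split => //.
  by move=> /(entails_not_conj _ hS).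
by move=> /(entails_conj _ hS).
Qed.

Lemma inst_DP d : inst_D I (default_form d) <-> d \in D.
Proof.
split=> [[d' d'D /default_form_inj <-]|dD]; first exact: d'D.
by exists d; [exact: dD|].
Qed.

Lemma inst_PP d d' : inst_P I (default_form d, default_form d') <-> (d, d') \in P.
Proof.
split=> [[[x y] xyP e]|h]; last by exists (d, d').
by move: xyP; have [/default_form_inj <- /default_form_inj <-] :=
  (f_equal fst e, f_equal snd e).
Qed.

(** By the induction hypothesis the conditions on a default in [stage] agree with [fires], so both
    constructions add the same conclusions in each round. *)
Lemma theory_of_stage i : theory_of (stage_form i) (conclusions (applied i)).
Proof.
have concl v A : all (sat_lit v) (conclusions A) <->
    (forall d : rule, d \in A -> all (sat_lit v) d.2).
  split=> [/allP h d dA|h].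
    by apply/allP => l ld; apply: h; rewrite mem_conclusions; apply/hasP; exists d.
  by apply/allP => l; rewrite mem_conclusions => /hasP[d /h /allP hd /hd].
elim: i => [|i IH] v.
  rewrite /models andbT; split=> [h|/allP h g [c cW <-]].
    by apply/allP => c cW; rewrite -eval_clause; apply: h; exists c.
  by rewrite eval_clause; apply: h.
have firesP d : d \in D -> fires D W P q (applied i) d <->
    [/\ inst_D I (default_form d), entails (stage_form i) (prereq (default_form d)),
      ~ entails (stage_form i) (Not (conseq (default_form d))) &
      ~ exists d', [/\ inst_D I d', inst_P I (d', default_form d) &
                       active (stage_form i) d']].
  move=> dD; split.
    move=> /and3P[h0 h1 /hasPn h2]; split; first exact/inst_DP.
    - exact/(entails_conj _ IH).
    - by move=> /(entails_not_conj _ IH); apply/negP.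
    - move=> [_ [[x xD <-] /inst_PP xP /(active_rule _ IH) xa]].
      by have := h2 x xD; rewrite xP xa.
  move=> [_ /(entails_conj _ IH) h0 h1 h2]; apply/and3P; split => //.
    by apply/negP => /(entails_not_conj _ IH).
  apply/hasPn => x xD; apply/negP => /andP[xP xa]; apply: h2; exists (default_form x).
  by split; [apply/inst_DP|apply/inst_PP|apply/(active_rule _ IH)].
split=> [h|/andP[mW /concl mA] g [|]].
- have /IH /andP[mW /concl mA] : forall g, stage_form i g -> eval v g.
    by move=> g gS; apply: h; left.
  apply/andP; split => //; apply/concl => d.
  rewrite /= mem_filter => /andP[/orP[/mA //|fd] dD].
  rewrite -eval_conj; apply: h; right; exists (default_form d) => //.
  by have /firesP := fd; apply.
(* Formulae of the previous stage remain true because [applied i] is contained in [applied i.+1]. *)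
- move=> gS; have : forall g, stage_form i g -> eval v g; last exact.
  apply/IH/andP; split => //; apply/concl => d dA; apply: mA.
  rewrite /= mem_filter dA /=.
  move: dA; rewrite /applied; have [p ->] := iter_inflate_filter D (fires D W P q) i.
  by rewrite mem_filter => /andP[].
- move=> [_ [[d dD <-] h0 h1 h2] <-]; rewrite /= eval_conj; apply: mA.
  rewrite /= mem_filter dD andbT; apply/orP; right; apply/firesP => //.
  by split => //; apply/inst_DP.
Qed.

Lemma decide_correct : decide (input_of I) <-> yes_instance I.
Proof.
have [_ _ totP] := valid.
have stageE i : entails (stage_form i) (lit_form q) <->
    unsat W q (neg q :: conclusions (applied i)).
  have := entails_conj [:: q] (theory_of_stage i).
  by rewrite /derives /= andbT.
rewrite /decide /=; split=> [dec E [T [totT PT ->]]|yes].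
  rewrite (strict_total_order_maximal totP totT PT).
  (* The final iterate of [inflate] is by definition the one after [size D] rounds. *)
  by exists (size D) => //; apply/stageE.
(* Conversely, the priority order itself yields an extension. The query follows at some stage [i],
   whose conclusions are all among the final ones, so no model of the latter refutes the query. *)
have [|i _ /stageE /(unsatP _ _ clausesP) h] :=
  yes (\bigcup_i Cn (stage_form i))%classic.
  by exists (inst_P I); split.
apply/(unsatP _ _ clausesP) => v; apply: contra (h v) => /andP[mW mL].
apply/andP; split => //; apply/allP => l; rewrite inE => lin; apply: (allP mL).
rewrite inE; case/orP: lin => [->//|]; rewrite !mem_conclusions => /hasP[d dA ld].
by apply/orP; right; apply/hasP; exists d => //; apply: iter_inflate_sub dA.
Qed.

End Stages.

(** * Assembly of the deciding machine *)

Theorem corollary4p10 :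
  poly_time_decidable enc_instance valid_instance yes_instance.
Proof.
have [c1 [K h1]] := transcodable_input.
have [c2 [N [[k lk] h2]]] := FP_decide.
pose c := (c1 ;; flush rA) ;; c2.
have runs_c z : runs c (main (enc_input z)) (main (code (decide z)))
    (((K + 5 * K + 1) * (size (enc_input z)).+1) + (K * size (enc_input z)).+2 ^ k).
  have [g s r] := h1 z.
  apply: (@runs_seq _ _ _ (main (code z ++ [::]))).
  - apply: runs_seq; first by have := r [::] [::]; rewrite cats0; apply.
      by rewrite -catrev_catrev; apply: runs_flushA.
    exact: leqnn.
  - by have := h2 z [::]; rewrite [code (decide z) ++ _]cats0; apply.
  - rewrite catrevE cats0 size_rev.
    have le : (tsize z).+2 <= (K * size (enc_input z)).+2 by [].
    by have := leq_trans (lk z) (leq_expl k le); nia.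
exists (decider c).
(* The summands bound the conversion of the input with the flush to the main stack, the decision on
   a tree at most [K] times as long as the input, and the last step, which inspects the answer. *)
exists ((K + 5 * K + 1)%N%:P * ('X + 1%:P) + (K%:P * 'X + 2%:P) ^+ k + 1%:P)%R.
move=> I valid.
have [n ln e] := runs_c (input_of I).
have [halt acc] := decider_correct e.
exists n.+1; last first.
  split => //; rewrite acc -(decide_correct valid) /=.
  by case: (decide _).
rewrite !(hornerD, hornerM, horner_exp, hornerX, hornerC).
suff : n < (K + 5 * K + 1) * (size (enc_instance I) + 1) +
    (K * size (enc_instance I) + 2) ^ k + 1 by [].
by rewrite !addn1 ltnS addn2; rewrite !addn1 in ln.
Qed.
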